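(* Let $f\in\mathrm{Diff}_+^{1+AC}(\mathbb{S}^1)$ and suppose that there exists a subarc $[a,b]$ of $\mathbb{S}^1$ with the property that the intervals $[f^i(a),f^i(b)]$ ($i\in\mathbb{Z}$) are pairwise disjoint, and either $f''\geq 0$ on $[f^i(a),f^i(b)]$ for every $i\in\mathbb{Z}$, or $f''\leq 0$ on $[f^i(a),f^i(b)]$ for every $i\in\mathbb{Z}$. Then $$\lim_{n\rightarrow\infty}\dfrac{d(f^n,e)}{n}\geq \left|\sum_{i\in\mathbb{Z}}\int_{f^i(a)}^{f^i(b)}\dfrac{f''}{f'}\right|,$$ where $d(f,g)=\int_{\mathbb{S}^1}\left|\frac{f''}{f'}-\frac{g''}{g'}\right|$ and $e$ is the identity.
   Context: $\mathbb{S}^1$ is $[0,1]$ with endpoints identified (i.e. $\mathbb{R}/\mathbb{Z}$). $\mathrm{Diff}_+^{1+AC}(\mathbb{S}^1)$ is the group (under composition) of orientation-preserving $C^1$ diffeomorphisms of $\mathbb{S}^1$ whose first derivative is absolutely continuous; the second derivative $f''$ is defined almost everywhere, and inequalities on $f''$ are understood almost everywhere. $[f^i(a),f^i(b)]$ denotes the arc $f^i([a,b])$, and $\int_{f^i(a)}^{f^i(b)}$ the integral over this arc. $d$ is a right-invariant pseudometric on the group, so $n\mapsto d(f^n,e)$ is subadditive and the limit on the left exists. *)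

(* Defs.v *)
From mathcomp Require Import all_boot all_order all_algebra.
From mathcomp Require Import all_classical all_reals all_analysis.

Set Implicit Arguments.
Unset Strict Implicit.
Unset Printing Implicit Defensive.

Import Order.TTheory GRing.Theory Num.Theory.
Import numFieldNormedType.Exports.

Local Open Scope classical_set_scope.
Local Open Scope ring_scope.

Section circle.
Variable R : realType.

Definition int_cong (x y : R) : bool := x - y \is a Num.int.

Lemma int_cong_refl : reflexive int_cong.
Proof. by move=> x; rewrite /int_cong subrr rpred0. Qed.

Lemma int_cong_sym : symmetric int_cong.
Proof. by move=> x y; rewrite /int_cong -opprB rpredN. Qed.

Lemma int_cong_trans : transitive int_cong.
Proof.
by move=> y x z xy yz; rewrite /int_cong -(subrKA y); exact: rpredD.
Qed.

Canonical int_cong_equiv : equiv_rel R :=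
  EquivRel int_cong int_cong_refl int_cong_sym int_cong_trans.

(* the circle R / Z *)
Definition circle := {eq_quot int_cong_equiv}%qT.

Definition toC (x : R) : circle := (\pi_circle x)%qT.

Lemma toC_eq (x y : R) : (toC x == toC y) = (x - y \is a Num.int).
Proof. by rewrite /toC eqmodE. Qed.

End circle.

Arguments toC {R} x.

Section calculus.
Variable R : realType.
Implicit Types (f g : circle R -> circle R) (A : set (circle R)).

Definition is_lift f (F : R -> R) : Prop :=
  continuous F /\ forall x, toC (F x) = f (toC x).

(* Two continuous lifts of f differ by an integer constant, so the derivative
   of f below does not depend on the lift selected here. *)
Definition clift f : R -> R := xget (id : R -> R) [set F : R -> R | is_lift f F].

Definition cderiv f (p : circle R) : R := derive1 (clift f) (repr p).

(* The pullback of [cderiv f] to R is 1-periodic. The value at the points where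
   it is not differentiable is irrelevant: f'' is only considered almost
   everywhere. *)
Definition cderiv2 f (p : circle R) : R :=
  derive1 (fun x : R => cderiv f (toC x)) (repr p).

Definition is_C1 f : Prop :=
  exists F : R -> R,
    [/\ is_lift f F, forall x, derivable F x 1 & continuous (derive1 F)].

Definition orientation_preserving f : Prop :=
  exists2 F : R -> R, is_lift f F & {homo F : x y / x < y}.

Definition abs_continuous (a b : R) (h : R -> R) : Prop :=
  forall e : R, 0 < e -> exists2 d : R, 0 < d &
    forall (n : nat) (u v : 'I_n -> R),
      (forall i, [/\ a <= u i, u i <= v i & v i <= b]) ->
      trivIset setT (fun i => `]u i, v i[%classic) ->
      \sum_(i < n) (v i - u i) < d ->
      \sum_(i < n) `|h (v i) - h (u i)| < e.

(* Diff_+^{1+AC}(S^1) *)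
Record diff1AC := Diff1AC {
  dfun :> circle R -> circle R;
  dinv : circle R -> circle R;
  dfunK : cancel dfun dinv;
  dinvK : cancel dinv dfun;
  dfun_C1 : is_C1 dfun;
  dinv_C1 : is_C1 dinv;
  dfun_orient : orientation_preserving dfun;
  dfun_AC : abs_continuous 0 1 (fun x => cderiv dfun (toC x)) }.

Definition ziter (f : diff1AC) (i : int) : circle R -> circle R :=
  match i with
  | Posz n => iter n f
  | Negz n => iter n.+1 (dinv f)
  end.

(* integral over A with respect to the Lebesgue measure of the circle, [0, 1[
   being a fundamental domain for the action of Z by translations *)
Definition cintegral A (h : circle R -> R) : R :=
  \int[@lebesgue_measure R]_(x in `[0, 1[ `&` toC @^-1` A) h (toC x).

Definition ae_on A (P : circle R -> Prop) : Prop :=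
  {ae @lebesgue_measure R, forall x, A (toC x) -> P (toC x)}.

Definition cdist f g : R :=
  cintegral setT
    (fun p => `|cderiv2 f p / cderiv f p - cderiv2 g p / cderiv g p|).

(* the arc of the circle running from a (mod 1) to b (mod 1), for
   a <= b < a + 1 *)
Definition carc (a b : R) : set (circle R) := toC @` `[a, b].

(* meaningful when both one-sided series converge, e.g. for summable u *)
Definition zsum (u : int -> R) : R :=
  limn (series (fun n => u (Posz n))) + limn (series (fun n => u (Negz n))).

End calculus.

(* Main.v *)
From HB Require Import structures.
Require Import Defs.
From mathcomp Require Import all_boot all_order all_algebra.
From mathcomp Require Import all_classical all_reals all_analysis.
From mathcomp Require Import measurable_realfun zify ring lra.
Import Order.TTheory GRing.Theory Num.Theory.
Import numFieldNormedType.Exports.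
Local Open Scope classical_set_scope.
Local Open Scope ring_scope.

Set Implicit Arguments.
Unset Strict Implicit.
Unset Printing Implicit Defensive.

(** Let F be a lift of f and l_n := ln (F^n)'. Since l_n is absolutely
    continuous, it is the primitive of f^n''/f^n' and d(f^n, e) is its total
    variation over a period. The cocycle relation l_(m+n) = l_m o F^n + l_n makes
    d(f^n, e) subadditive in n, so that d(f^n, e) / n converges by Fekete's lemma.
    Writing c_k for the integral of f''/f' over the arc f^k([a, b]), the cocycle
    relation also says that the integral of f^n''/f^n' over f^k([a, b]) is
    c_k + ... + c_(k+n-1). As the arcs are disjoint, d(f^n, e) is at least
    |sum_k (c_k + ... + c_(k+n-1))| = n |sum_k c_k|; divide by n.

    The fundamental theorem of calculus for an absolutely continuous h is obtained
    from the Jordan decomposition of h: the Stieltjes measure of a monotone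
    absolutely continuous function is dominated by the Lebesgue measure, its
    Radon-Nikodym density integrates to the function, and Lebesgue's
    differentiation theorem identifies the density with the derivative. *)

(** * Absolute continuity and total variation *)

Section interval_families.
Context {R : realType}.
Implicit Types (a b c : R) (p q : R * R) (s : seq (R * R)) (h phi : R -> R).

(* Families of non-overlapping intervals are lists of pairs of endpoints: refining
   an interval of the family is then a substitution in the list. *)
Definition sep p q := (p.2 <= q.1) || (q.2 <= p.1).

Definition subitv a b p := [&& a <= p.1, p.1 <= p.2 & p.2 <= b].

Definition subitvs a b s := all (subitv a b) s && pairwise sep s.

Definition length_sum s := \sum_(p <- s) (p.2 - p.1).

Definition incr_sum h s := \sum_(p <- s) `|h p.2 - h p.1|.

Definition absc a b h := forall e, 0 < e -> exists2 d, 0 < d &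
  forall s, subitvs a b s -> length_sum s < d -> incr_sum h s < e.

Lemma abs_continuous_absc a b h : abs_continuous a b h -> absc a b h.
Proof.
move=> ac e /ac[d d0 H]; exists d => // s /andP[/allP sab sepS] lS.
have := H (size s) (fun i => (tnth (in_tuple s) i).1)
  (fun i => (tnth (in_tuple s) i).2).
rewrite /length_sum big_tnth in lS.
have -> : incr_sum h s = \sum_(i < size s)
    `|h (tnth (in_tuple s) i).2 - h (tnth (in_tuple s) i).1|.
  by rewrite /incr_sum big_tnth.
apply.
- by move=> i; have /sab/and3P[] := mem_tnth i (in_tuple s).
- move=> i j _ _ [x [/=]]; rewrite !in_itv/= !(tnth_nth (0, 0))/=.
  (* A common point of two open intervals contradicts their separation; [pairwise] compares
     positions [k < l] only. *)
  have lt_case (k l : 'I_(size s)) : (k < l)%N ->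
      (nth (0, 0) s k).1 < x < (nth (0, 0) s k).2 ->
      (nth (0, 0) s l).1 < x < (nth (0, 0) s l).2 -> False.
    move=> kl /andP[ux xv] /andP[u'x xv'].
    have /(pairwiseP (0, 0))/(_ k l (ltn_ord k) (ltn_ord l) kl) := sepS.
    by move=> /orP[]; lra.
  move=> xi xj; apply/val_inj.
  by case: (ltngtP i j) => // ij; exfalso; [exact: (lt_case i j)|exact: (lt_case j i)].
- exact: lS.
Qed.

Lemma subitvs_map a b a' b' phi s :
  (forall x, a <= x <= b -> a' <= phi x <= b') ->
  (forall x y, a <= x -> x <= y -> y <= b -> phi x <= phi y) ->
  subitvs a b s -> subitvs a' b' [seq (phi p.1, phi p.2) | p <- s].
Proof.
move=> phiab phile /andP[/allP sab sepS]; apply/andP; split.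
  apply/allP => _ /mapP[p /sab/and3P[ap pp pb] ->]/=; apply/and3P; split => /=.
  - by have /andP[] := phiab p.1 ltac:(lra).
  - exact: phile.
  - by have /andP[] := phiab p.2 ltac:(lra).
rewrite pairwise_map.
apply: (sub_in_pairwise (P := [in s])); last exact: sepS; last first.
  by apply/allP.
move=> p q /sab/and3P[ap pp pb] /sab/and3P[aq qq qb] /orP[pq|qp]; apply/orP => /=.
  by left; apply: phile => //; lra.
by right; apply: phile => //; lra.
Qed.

(** A nondecreasing [k]-Lipschitz map sends a family of separated intervals to another such family,
    of total length at most [k] times as large. *)
Lemma absc_comp a b a' b' h phi (k : R) : 0 <= k ->
  (forall x, a <= x <= b -> a' <= phi x <= b') ->
  (forall x y, a <= x -> x <= y -> y <= b -> phi x <= phi y <= phi x + k * (y - x)) ->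
  absc a' b' h -> absc a b (h \o phi).
Proof.
(* The denominator is [k + 1] because [k] may be 0. *)
move=> k0 phiab phik ac e /ac[d d0 H]; exists (d / (k + 1)).
  by rewrite divr_gt0//; lra.
move=> s sab ls.
have := H _ (subitvs_map phiab _ sab).
rewrite /incr_sum big_map; apply.
  by move=> x y ax xy yb; have /andP[] := phik _ _ ax xy yb.
rewrite /length_sum big_map/=.
apply: (@le_lt_trans _ _ (k * length_sum s)).
  rewrite /length_sum mulr_sumr big_seq [leRHS]big_seq; apply: ler_sum => p ps.
  case/andP: sab => /allP/(_ p ps)/and3P[ap pp pb] _.
  by have /andP[_] := phik _ _ ap pp pb; rewrite lerBlDl.
rewrite ltr_pdivlMr in ls; last lra.
apply: le_lt_trans ls; rewrite mulrC ler_wpM2l//; last lra.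
rewrite /length_sum big_seq; apply: sumr_ge0 => p ps.
case/andP: sab => /allP/(_ p ps)/and3P[ap pp pb] _; lra.
Qed.

Lemma eq_absc a b h h' : (forall x, a <= x <= b -> h x = h' x) ->
  absc a b h -> absc a b h'.
Proof.
move=> hh' ac e /ac[d d0 H]; exists d => // s sab ls; move: (H s sab ls).
congr (_ < _); apply: eq_big_seq => p ps.
case/andP: sab => /allP/(_ p ps)/and3P[ap pp pb] _.
by rewrite !hh'//; lra.
Qed.

Lemma absc_sub a b a' b' h : a <= a' -> b' <= b -> absc a b h -> absc a' b' h.
Proof.
move=> aa' bb'; apply: (@absc_comp _ _ _ _ h id 1); first exact: ler01.
  by move=> x; lra.
by move=> x y; rewrite mul1r; lra.
Qed.

Lemma absc_translate a b h t : absc (a + t) (b + t) h -> absc a b (fun x => h (x + t)).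
Proof.
apply: (@absc_comp _ _ _ _ h (fun x => x + t) 1); first exact: ler01.
  by move=> x; lra.
by move=> x y; rewrite mul1r; lra.
Qed.

(** The truncations [min x c] and [max x c] cut a family at [c] into one on each side, neither
    longer than the original. *)
Lemma absc_cat a b c h : absc a c h -> absc c b h -> absc a b h.
Proof.
move=> ac cb e e0.
have [d d0 H] := ac (e / 2) ltac:(lra).
have [d' d'0 H'] := cb (e / 2) ltac:(lra).
exists (Num.min d d'); first by rewrite lt_min d0.
move=> s sab; rewrite lt_min => /andP[ls ls'].
pose f x := Num.min x c; pose g x := Num.max x c.
have [fle gle] : {homo f : x y / x <= y} /\ {homo g : x y / x <= y}.
  split=> x y xy; rewrite /f /g.
    by rewrite le_min !ge_min xy lexx orbT.
  by rewrite ge_max !le_max xy lexx orbT.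
have fl x y : x <= y -> f y - f x <= y - x.
  by move=> xy; rewrite /f; case: (leP x c); case: (leP y c); lra.
have gl x y : x <= y -> g y - g x <= y - x.
  by move=> xy; rewrite /g; case: (leP x c); case: (leP y c); lra.
have {}H : incr_sum h [seq (f p.1, f p.2) | p <- s] < e / 2.
  (* For [c < a] the truncation [f] is constant on [[a, b]] and the sum vanishes. *)
  have [ac'|ca] := leP a c; last first.
    rewrite /incr_sum big_map big_seq big1 ?divr_gt0// => p ps.
    case/andP: sab => /allP/(_ p ps)/and3P[ap pp pb] _.
    by rewrite /f /= !min_r ?subrr ?normr0//; lra.
  apply: H.
    apply: (@subitvs_map a b _ _ f) => //; last by move=> x y _ /fle.
    move=> x xab; rewrite /f; case: (leP x c); lra.
  apply: le_lt_trans ls; rewrite /length_sum big_map/= big_seq [leRHS]big_seq.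
  apply: ler_sum => p ps; apply: fl.
  by case/andP: sab => /allP/(_ p ps)/and3P[].
have {}H' : incr_sum h [seq (g p.1, g p.2) | p <- s] < e / 2.
  have [cb'|bc] := leP c b; last first.
    rewrite /incr_sum big_map big_seq big1 ?divr_gt0// => p ps.
    case/andP: sab => /allP/(_ p ps)/and3P[ap pp pb] _.
    by rewrite /g /= !max_r ?subrr ?normr0//; lra.
  apply: H'.
    apply: (@subitvs_map a b _ _ g) => //; last by move=> x y _ /gle.
    move=> x xab; rewrite /g; case: (leP x c); lra.
  apply: le_lt_trans ls'; rewrite /length_sum big_map/= big_seq [leRHS]big_seq.
  apply: ler_sum => p ps; apply: gl.
  by case/andP: sab => /allP/(_ p ps)/and3P[].
apply: le_lt_trans (_ : incr_sum h [seq (f p.1, f p.2) | p <- s] +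
  incr_sum h [seq (g p.1, g p.2) | p <- s] < _); last lra.
rewrite /incr_sum !big_map/= -big_split/=; apply: ler_sum => p _.
apply: (le_trans _ (ler_normD _ _)).
(* This rests on [h (f x) + h (g x) = h x + h c]. *)
suff -> : h p.2 - h p.1 = h (f p.2) - h (f p.1) + (h (g p.2) - h (g p.1)) by [].
by rewrite /f /g; case: (leP p.2 c) => _; case: (leP p.1 c) => _; ring.
Qed.

Lemma abscD a b h h' : absc a b h -> absc a b h' -> absc a b (h \+ h').
Proof.
move=> ac ac' e e0.
have [d d0 H] := ac (e / 2) ltac:(lra).
have [d' d'0 H'] := ac' (e / 2) ltac:(lra).
exists (Num.min d d'); first by rewrite lt_min d0.
move=> s sab; rewrite lt_min => /andP[/(H _ sab) hs /(H' _ sab) h's].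
apply: le_lt_trans (_ : incr_sum h s + incr_sum h' s < _); last lra.
rewrite /incr_sum -big_split/=; apply: ler_sum => p _.
by rewrite opprD addrACA; exact: ler_normD.
Qed.

Lemma absc_post a b (k : R) h (g : R -> R) : 0 < k ->
  (forall x y, a <= x <= b -> a <= y <= b ->
    `|g (h y) - g (h x)| <= k * `|h y - h x|) ->
  absc a b h -> absc a b (g \o h).
Proof.
move=> k0 gk ac e e0; have [d d0 H] := ac (e / k) ltac:(exact: divr_gt0).
exists d => // s sab /(H _ sab); rewrite ltr_pdivlMr// mulrC => /le_lt_trans; apply.
rewrite /incr_sum mulr_sumr big_seq [leRHS]big_seq; apply: ler_sum => p ps.
case/andP: sab => /allP/(_ p ps)/and3P[ap pp pb] _.
by apply: gk; lra.
Qed.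

Lemma periodic_intr h : (forall x, h (x + 1) = h x) ->
  forall (m : int) x, h (x + m%:~R) = h x.
Proof.
move=> h1.
have hn (n : nat) y : h (y + n%:R) = h y.
  elim: n y => [|n IH] y; first by rewrite addr0.
  by rewrite -natr1 addrA h1.
case=> n x; first exact: hn.
by rewrite NegzE -[LHS](hn n.+1) mulrNz -addrA addNr addr0.
Qed.

(** An integer translation brings [c] to [r] in [[0, 1)]; there [[r, r + 1]] is cut at 1, and the
    part beyond 1 is a translate of [[0, r]]. *)
Lemma absc_periodic h : (forall x, h (x + 1) = h x) -> absc 0 1 h ->
  forall c, absc c (c + 1) h.
Proof.
move=> h1 ac c; pose m := Num.floor c; pose r := c - m%:~R.
have r01 : 0 <= r < 1.
  have := floor_itv c; rewrite -/m intrD mulr1z /r; lra.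
apply: (@eq_absc _ _ (fun x => h (x + (- m)%:~R))) => [x _|].
  by rewrite periodic_intr.
apply: absc_translate; rewrite mulrNz -/r addrAC -/r.
apply: (@absc_cat _ _ 1); first by apply: absc_sub ac => //; lra.
apply: (@eq_absc _ _ (fun x => h (x + (-1)))) => [x _|].
  by have := periodic_intr h1 (-1) x.
by apply: absc_translate; apply: absc_sub ac; lra.
Qed.

Lemma length_sum_cat s1 s2 : length_sum (s1 ++ s2) = length_sum s1 + length_sum s2.
Proof. exact: big_cat. Qed.

Lemma incr_sum_cat h s1 s2 : incr_sum h (s1 ++ s2) = incr_sum h s1 + incr_sum h s2.
Proof. exact: big_cat. Qed.

Definition steps a (l : seq R) := zip (a :: l) l.

Lemma variation_steps a b h l : variation a b h l = incr_sum h (steps a l).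
Proof.
rewrite /variation /incr_sum /steps (big_nth (a, a)) size_zip/= (minn_idPr _)//.
apply: eq_big_nat => i /andP[_ il].
rewrite nth_zip_cond size_zip/= (minn_idPr _)// il/=.
by congr (`|h _ - h _|); apply: set_nth_default => //=; rewrite leqW.
Qed.

Lemma subitvs_steps a l : path <%R a l ->
  subitvs a (last a l) (steps a l) /\ length_sum (steps a l) = last a l - a.
Proof.
elim: l a => [|x l IH] a /=.
  by split=> //; rewrite /length_sum /steps/= big_nil subrr.
move=> /andP[ax xl]; have [/andP[/allP sub sepS] lS] := IH _ xl.
have xlast : x <= last x l.
  elim: l x {ax IH lS sub sepS} xl => //= y l IH x /andP[xy /IH yl].
  by apply: le_trans yl; exact: ltW.
split; last first.
  by rewrite /length_sum /steps/= big_cons/= -/(steps x l) -/(length_sum _) lS; ring.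
rewrite /subitvs /steps/= -/(steps x l) /subitv/= lexx (ltW ax) xlast sepS/= andbT.
apply/andP; split; apply/allP => p /sub /and3P[xp pp pl].
  by apply/and3P; split => //; lra.
by rewrite /sep/= xp.
Qed.

(** The parentheses leave [s1 ++ t] as the refined part of the list, ready for the next interval of
    [s2]. *)
Lemma subitvs_refine a b s1 s2 p t : subitvs a b (s1 ++ p :: s2) ->
  subitvs p.1 p.2 t -> subitvs a b ((s1 ++ t) ++ s2).
Proof.
move=> /andP[]; rewrite all_cat /= => /and3P[A1 /and3P[ap pp pb] A2].
rewrite pairwise_cat/= => /and4P[]; rewrite allrel_consr => /andP[P1 P2] P3 P4 P5.
move=> /andP[/allP At Pt].
have sepl q r : r \in t -> sep q p -> sep q r.
  by move=> /At /and3P[? ? ?] /orP[] ?; apply/orP; [left|right]; lra.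
have sepr q r : r \in t -> sep p q -> sep r q.
  by move=> /At /and3P[? ? ?] /orP[] ?; apply/orP; [left|right]; lra.
apply/andP; split.
  rewrite !all_cat A1 A2 andbT/=; apply/allP => q /At /and3P[? ? ?].
  by apply/and3P; split; lra.
rewrite !pairwise_cat P3 Pt P5 /= !andbT allrel_catl P2/=; apply/andP; split.
  apply/allrelP => q r qt rs2; apply: (sepr _ _ qt).
  by move/allP : P4; apply.
apply/allrelP => q r qs1 rt; apply: (sepl _ _ rt).
by move/allP : P1; apply.
Qed.

Lemma incr_sum_ge0 h s : 0 <= incr_sum h s.
Proof. exact: sumr_ge0. Qed.

(** Subdividing each interval of a short family yields a family of the same length, whose increments
    still sum to less than [e]; the supremum over the subdivisions gives the total variations. *)
Lemma absc_total_variation a b h : absc a b h -> forall e, 0 < e ->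
  exists2 d, 0 < d & forall s, subitvs a b s -> length_sum s < d ->
  (\sum_(p <- s) total_variation p.1 p.2 h <= e%:E)%E.
Proof.
move=> ac e /ac[d d0 H]; exists d => // s sab ls.
(* the intervals are refined one at a time, s1 being the part already refined *)
suff : forall s1, subitvs a b (s1 ++ s) -> length_sum (s1 ++ s) < d ->
   ((incr_sum h s1)%:E + \sum_(p <- s) total_variation p.1 p.2 h <= e%:E)%E.
  move=> /(_ [::]); rewrite /incr_sum big_nil add0e; exact.
elim: s {sab ls} => [|p s IH] s1 s1s l1s.
  by rewrite big_nil adde0 lee_fin ltW// H// -[s1]cats0.
have refine t : subitvs p.1 p.2 t -> length_sum t <= p.2 - p.1 ->
    ((incr_sum h s1 + incr_sum h t)%:E + \sum_(p <- s) total_variation p.1 p.2 h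
     <= e%:E)%E.
  move=> subt lt; rewrite -incr_sum_cat; apply: IH.
    exact: subitvs_refine subt.
  apply: le_lt_trans l1s; rewrite !length_sum_cat -addrA lerD2l.
  by rewrite /length_sum big_cons lerD2r.
have pab : subitv a b p.
  by case/andP: s1s; rewrite all_cat/= => /and3P[].
have pp : p.1 <= p.2 by case/and3P: pab.
have B0 : (0 <= \sum_(p <- s) total_variation p.1 p.2 h)%E.
  rewrite big_seq; apply: sume_ge0 => q qs; apply: total_variation_ge0.
  case/andP: s1s; rewrite all_cat/= => /and3P[_ _ /allP/(_ q qs)].
  by case/and3P.
rewrite big_cons; set B := (\sum_(p <- s) _)%E in refine B0 *.
(* The empty family as [t] bounds [B] by [e]; finiteness of [B] permits its subtraction in the
   extended reals. *)
have Bfin : B \is a fin_num.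
  rewrite ge0_fin_numE//; apply: le_lt_trans (ltry e).
  apply: le_trans (refine [::] _ _) => //; last first.
    by rewrite /length_sum big_nil subr_ge0.
  by rewrite leeDr// lee_fin addr_ge0// incr_sum_ge0.
rewrite -(fineK Bfin) in refine *.
rewrite addeCA -EFinD -leeBrDr// -EFinB.
apply: ge_ereal_sup => _ [_ [l [pl /eqP lastl] <-] <-].
rewrite variation_steps lee_fin.
have [] := subitvs_steps pl; rewrite lastl => subl ll.
have := refine _ subl; rewrite ll lexx -EFinD lee_fin => /(_ erefl).
by lra.
Qed.

(** Absolute continuity with [e = 1] bounds the variation on intervals of length [d / 2] by 1, and
    finitely many of them cover [[a, b]]. *)
Lemma absc_bounded_variation a b h : a <= b -> absc a b h -> bounded_variation a b h.
Proof.
move=> ab ac; apply/bounded_variationP => //.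
have [d d0 H] := absc_total_variation ac ltr01.
have step u v : a <= u -> u <= v -> v <= b -> v - u <= d / 2 ->
    (total_variation u v h < +oo)%E.
  move=> au uv vb vud; have := H [:: (u, v)].
  rewrite /length_sum !big_seq1/= => /(_ _ _)/le_lt_trans; apply; rewrite ?ltry//.
    by rewrite /subitvs/= /subitv/= au uv vb.
  by apply: le_lt_trans vud _; rewrite ltr_pdivrMr//; lra.
rewrite ge0_fin_numE ?total_variation_ge0//.
suff : forall n : nat, forall x, a <= x <= b -> x - a <= n%:R * (d / 2) ->
    (total_variation a x h < +oo)%E.
  move=> /(_ (Num.bound ((b - a) / (d / 2))) b); apply; first by rewrite ab lexx.
  rewrite -ler_pdivrMr; last lra.
  by apply/ltW/archi_boundP; rewrite divr_ge0//; lra.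
elim => [|n IH] x /andP[ax xb].
  rewrite mul0r => xa; have -> : x = a by lra.
  by rewrite total_variationxx.
move=> xn; pose y := Num.max a (x - d / 2).
have ay : a <= y by rewrite le_max lexx.
have yx : y <= x by rewrite ge_max ax; lra.
rewrite (total_variationD h ay yx) lte_add_pinfty//.
  apply: IH; first by rewrite ay (le_trans yx).
  rewrite -natr1 in xn; rewrite /y; case: (leP a) => _; first lra.
  by rewrite subrr mulr_ge0//; lra.
by apply: step => //; rewrite /y; case: (leP a) => ?; lra.
Qed.

Lemma total_variation_fine_split a b h u v : bounded_variation a b h ->
  a <= u -> u <= v -> v <= b ->
  fine (total_variation a v h) - fine (total_variation a u h) =
  fine (total_variation u v h).
Proof.
move=> bv au uv vb.
have uvfin : total_variation u v h \is a fin_num.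
  apply/bounded_variationP => //; apply: (bounded_variationl uv vb).
  by apply: (bounded_variationr au) bv; exact: le_trans vb.
have aufin : total_variation a u h \is a fin_num.
  apply/bounded_variationP => //; apply: bounded_variationl bv => //.
  exact: le_trans vb.
by rewrite (total_variationD h au uv) fineD// addrAC subrr add0r.
Qed.

(** With [V] the variation function of [h], the choice is [(V + h) / 2] and [(V - h) / 2]. The
    halves make the growth of [P] plus that of [N] exactly the total variation, hence a sharp bound
    on the density below. *)
Lemma absc_jordan a b h : a <= b -> absc a b h ->
  exists P N : R -> R,
  [/\ forall x y, a <= x -> x <= y -> y <= b -> P x <= P y,
      forall x y, a <= x -> x <= y -> y <= b -> N x <= N y,
      absc a b P, absc a b N &
      h = P \- N /\
      P b - P a + (N b - N a) = fine (total_variation a b h)].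
Proof.
move=> ab ac; pose V x := fine (total_variation a x h).
have bv := absc_bounded_variation ab ac.
have VE u v : a <= u -> u <= v -> v <= b ->
    V v - V u = fine (total_variation u v h).
  exact: total_variation_fine_split.
have hV u v : a <= u -> u <= v -> v <= b -> `|h v - h u| <= V v - V u.
  move=> au uv vb; rewrite VE// -lee_fin fineK; first exact: total_variation_ge.
  apply/bounded_variationP => //; apply: (bounded_variationl uv vb).
  by apply: (bounded_variationr au) bv; exact: le_trans vb.
(* The increments of [V] over a family are the total variations of [h] over its intervals. *)
have Vac : absc a b V.
  move=> e e0; have [d d0 H] := absc_total_variation ac (ltac:(lra) : 0 < e / 2).
  exists d => // s sab ls; apply: le_lt_trans (_ : e / 2 < e); last lra.
  rewrite -lee_fin; apply: le_trans (H s sab ls).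
  rewrite /incr_sum -sumEFin big_seq [leRHS]big_seq; apply: lee_sum => p ps.
  case/andP: sab => /allP/(_ p ps)/and3P[ap pp pb] _.
  have := hV _ _ ap pp pb; rewrite VE// => /(le_trans (normr_ge0 _)) V0.
  rewrite ger0_norm// fineK//.
  apply/bounded_variationP => //; apply: (bounded_variationl pp pb).
  by apply: (bounded_variationr ap) bv; exact: le_trans pb.
have half k : absc a b k -> absc a b (fun x => k x / 2).
  apply: (@absc_post _ _ 1 k (fun x => x / 2)) => // x y _ _.
  rewrite -mulrBl normrM mul1r [`|2^-1|]ger0_norm ?invr_ge0//.
  by have := normr_ge0 (k y - k x); lra.
have acN : absc a b (\- h).
  by apply: (@absc_post _ _ 1 h -%R) ac => // x y _ _; rewrite mul1r -opprD normrN.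
exists (fun x => (V \+ h) x / 2), (fun x => (V \+ \- h) x / 2); split.
- by move=> x y ax xy yb; have := hV x y ax xy yb; rewrite ler_norml /=; lra.
- by move=> x y ax xy yb; have := hV x y ax xy yb; rewrite ler_norml /=; lra.
- exact/half/abscD.
- exact/half/abscD.
- split; first by apply/funext => x /=; field.
  by rewrite -(VE a b)//=; field.
Qed.

End interval_families.

(** * Density of an absolutely continuous function *)

Section density.
Context {R : realType}.
Notation mu := (@lebesgue_measure R).
Implicit Types (a b : R) (h : R -> R).

Lemma absc_continuous h : (forall a b, absc a b h) -> continuous h.
Proof.
move=> ac x; apply/cvgrPdist_lt => e e0.
have [d d0 H] := ac (x - 1) (x + 1) _ e0.
near=> y.
have yx1 : `|y - x| < 1.
  rewrite distrC; near: y; apply: (@cvgr_dist_lt _ _ _ _ _ id x) => //; exact: cvg_id.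
have yxd : `|y - x| < d.
  rewrite distrC; near: y; apply: (@cvgr_dist_lt _ _ _ _ _ id x) => //; exact: cvg_id.
have key u v : u <= v -> x - 1 <= u -> v <= x + 1 -> v - u < d -> `|h v - h u| < e.
  move=> uv xu vx vud; have := H [:: (u, v)].
  rewrite /length_sum /incr_sum !big_seq1/=; apply => //.
  by apply/andP; split => //=; rewrite andbT; apply/and3P; split.
move: yx1 yxd; have [xy|yx] := leP x y.
  by rewrite ger0_norm ?subr_ge0// => ? ?; rewrite distrC; apply: key => //; lra.
by rewrite ltr0_norm ?subr_lt0// => ? ?; apply: key; lra.
Unshelve. all: by end_near. Qed.

Section clamp.
Variables (a b : R).
Hypothesis ab : a <= b.

(** Composition with this projection of the line onto [[a, b]] extends a function by constants,
    keeping it monotone and absolutely continuous; a cumulative function has to live on the whole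
    line. *)
Definition clamp x := Num.max a (Num.min x b).

Lemma clamp_itv x : a <= clamp x <= b.
Proof.
move: ab; rewrite /clamp; case: (leP x b) => ?; last by case: (leP a b); lra.
by case: (leP a x); lra.
Qed.

Lemma clamp_id x : a <= x <= b -> clamp x = x.
Proof.
by rewrite /clamp; case: (leP x b) => ?; [case: (leP a x)|case: (leP a b)] => ?; lra.
Qed.

Lemma clamp_lip x y : x <= y -> clamp x <= clamp y <= clamp x + (y - x).
Proof.
by rewrite /clamp; case: (leP x b) => ?; case: (leP y b) => ?;
  case: (leP a x) => ?; case: (leP a y) => ?; case: (leP a b) => ?; lra.
Qed.

Lemma absc_clamp h c d : absc a b h -> absc c d (h \o clamp).
Proof.
apply: (@absc_comp _ _ _ _ _ h clamp 1) => //; first by move=> x _; exact: clamp_itv.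
by move=> x y _ xy _; rewrite mul1r; exact: clamp_lip.
Qed.

End clamp.

(** * Stieltjes measures of absolutely continuous functions *)

Lemma stieltjes_itv_oc (F : cumulative R R) x y : x <= y ->
  lebesgue_stieltjes_measure F `]x, y]%classic = (F y - F x)%:E.
Proof.
move=> xy; rewrite /lebesgue_stieltjes_measure /measure_extension/=.
by rewrite measurable_mu_extE/= ?wlength_itv_bnd//; exact: is_ocitv.
Qed.

Lemma open_bounded_interval (A : set R) a b : open A -> is_interval A ->
  A `<=` `]a, b[ -> A !=set0 ->
  [/\ A = `]inf A, sup A[%classic, inf A < sup A, a <= inf A & sup A <= b].
Proof.
move=> oA iA Aab A0.
have lA : has_lbound A by exists a => x /Aab/=; rewrite in_itv/= => /andP[/ltW].
have uA : has_ubound A by exists b => x /Aab/=; rewrite in_itv/= => /andP[_ /ltW].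
have AE : A = `]inf A, sup A[%classic.
  have := interval_bounded_interior iA lA uA.
  rewrite (interior_id _).1// => {1}->.
split=> //.
- case: A0 => x Ax; have : `]inf A, sup A[%classic x by rewrite -AE.
  by rewrite /= in_itv/= => /andP[]; exact: lt_trans.
- by apply: lb_le_inf => // x /Aab/=; rewrite in_itv/= => /andP[/ltW].
- by apply: ge_sup => // x /Aab/=; rewrite in_itv/= => /andP[_ /ltW].
Qed.

Lemma sep_itv_oo (u v u' v' : R) : u < v -> u' < v' ->
  `]u, v[%classic `&` `]u', v'[%classic = set0 -> sep (u, v) (u', v').
Proof.
move=> uv uv' I0; apply/orP => /=; have [vu'|u'v] := leP v u'; first by left.
have [v'u|uv''] := leP v' u; first by right.
(* Otherwise the intervals share the midpoint of their intersection. *)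
exfalso; suff : set0 ((Num.max u u' + Num.min v v') / 2) by [].
by rewrite -I0; split; rewrite /= in_itv/=;
  case: (leP u u') => ?; case: (leP v v') => ?; lra.
Qed.

(** Outer regularity encloses [A] in an open set [W] of length less than [d]. Finitely many
    components of [W] form an admissible family, so their Stieltjes measures sum to less than [e];
    the bound passes to the limit. *)
Lemma absc_stieltjes_dominates (F : cumulative R R) a b : absc a b F ->
  forall A, measurable A -> A `<=` `]a, b[ -> mu A = 0 ->
  lebesgue_stieltjes_measure F A = 0.
Proof.
move=> ac A mA Aab A0; apply/eqP; rewrite eq_le measure_ge0 andbT.
apply/lee_addgt0Pr => e e0; rewrite add0e.
have [d d0 H] := ac _ e0.
have [U [oU AU UAd]] : exists U : set R,
    [/\ open U, A `<=` U & (mu (U `\` A) < d%:E)%E].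
  by apply: lebesgue_regularity_outer => //; rewrite [ltLHS]A0 ltry.
pose W := U `&` `]a, b[%classic.
have oW : open W by apply: openI => //; exact: interval_open.
have mUA : measurable (U `\` A) by apply: measurableD => //; exact: open_measurable.
have Wd : (mu W < d%:E)%E.
  apply: le_lt_trans UAd; rewrite -[leRHS]add0e -A0 -measureU//; last first.
    by rewrite setDE setICA setICr setI0.
  rewrite setDUK//; apply: le_measure; rewrite ?inE//; [|exact: open_measurable|].
    exact: open_measurable.
  exact: subIsetl.
pose I := open_disjoint_itv oW.
have mI n : measurable (I n) by apply: open_measurable; exact: open_disjoint_itv_open.
have WI : W = \bigcup_n I n by exact: open_disjoint_itv_bigcup.
have IW n : I n `<=` `]a, b[ by move=> x Ix; have : W x by [rewrite WI; exists n]; case.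
have tI : trivIset setT I by exact: open_disjoint_itv_trivIset.
have IE n : I n !=set0 -> [/\ I n = `]inf (I n), sup (I n)[%classic,
    inf (I n) < sup (I n), a <= inf (I n) & sup (I n) <= b].
  apply: open_bounded_interval => //; first exact: open_disjoint_itv_open.
  exact: open_disjoint_itv_is_interval.
apply: (@le_trans _ _ (lebesgue_stieltjes_measure F W)).
  apply: le_measure; rewrite ?inE//; first exact: open_measurable.
  by move=> x Ax; split; [exact: AU|exact: Aab].
have mI' n : measurable (I n : set (measurableTypeR R)) by exact: mI.
have measW (m : {measure set (measurableTypeR R) -> \bar R}) :
    m W = (\sum_(k <oo) m (I k))%E.
  by rewrite WI measure_semi_bigcup//; exact: bigcup_measurable.
rewrite measW; apply: lime_le => //; first exact: is_cvg_nneseries.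
apply: nearW => n.
(* Empty components are dropped, [inf] and [sup] of the empty set being default values. *)
pose s := [seq (inf (I k), sup (I k)) | k <- iota 0 n & `[< I k !=set0 >]].
have sab : subitvs a b s.
  apply/andP; split.
    apply/allP => _ /mapP[k + ->]; rewrite mem_filter => /andP[/asboolP/IE[_ ? ? ?] _].
    by apply/and3P; split => //; exact: ltW.
  rewrite pairwise_map.
  have : pairwise ltn [seq k <- iota 0 n | `[< I k !=set0 >]].
    rewrite -(sorted_pairwise ltn_trans).
    by apply: sorted_filter; [exact: ltn_trans|exact: iota_ltn_sorted].
  apply: sub_in_pairwise (filter_all _ _).
  move=> k l /asboolP/IE[kE kk _ _] /asboolP/IE[lE ll _ _] kl; apply: sep_itv_oo => //.
  rewrite -kE -lE; by apply: (trivIsetP.1 tI) => //; rewrite ltn_eqF.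
have sumI (m : {measure set (measurableTypeR R) -> \bar R}) :
    (\sum_(0 <= k < n) m (I k) =
    \sum_(k <- iota 0 n | `[< I k !=set0 >]) m (I k))%E.
  rewrite [RHS]big_mkcond /index_iota subn0; apply: eq_bigr => k _.
  case: asboolP => // /set0P/negP/negPn/eqP ->; exact: measure0.
have ls : length_sum s < d.
  rewrite -lte_fin; apply: le_lt_trans Wd.
  rewrite measW; apply: le_trans (nneseries_lim_ge n _) => //.
  rewrite (sumI mu) /length_sum big_map big_filter -sumEFin; apply: lee_sum => k.
  move=> /asboolP/IE[kE kk _ _] /=; rewrite [in leRHS]kE.
  by rewrite [leRHS]lebesgue_measure_itv/= lte_fin kk.
apply: le_trans (_ : (incr_sum F s)%:E <= _)%E; last by rewrite lee_fin ltW// H.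
rewrite sumI /incr_sum big_map big_filter -sumEFin; apply: lee_sum => k.
move=> /asboolP/IE[kE kk _ _]; rewrite ger0_norm; last first.
  by rewrite subr_ge0; exact/cumulative_is_nondecreasing/ltW.
rewrite /= -(stieltjes_itv_oc _ (ltW kk)).
(* The Stieltjes measure is known on half-open intervals, so each component is enlarged by its right
   endpoint. *)
have le_oc (m : {measure set (measurableTypeR R) -> \bar R}) :
    (m (I k) <= m `]inf (I k), sup (I k)]%classic)%E.
  apply: le_measure; [by rewrite inE|rewrite inE; exact: measurable_itv|].
  by rewrite {1}kE => x /=; rewrite !in_itv/= => /andP[-> /ltW].
exact: le_oc.
Qed.

(** The Stieltjes measure of [h], extended by constants, has a Radon-Nikodym density with respect to
    the Lebesgue measure; restricting it to []a, b]] makes it finite, so that the density is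
    integrable. *)
Lemma monotone_absc_density a b h : a <= b ->
  (forall x y, a <= x -> x <= y -> y <= b -> h x <= h y) -> absc a b h ->
  exists g : R -> R, [/\ forall x, 0 <= g x, mu.-integrable setT (EFin \o g) &
    forall x y, a <= x -> x <= y -> y <= b -> \int[mu]_(t in `[x, y]) g t = h y - h x].
Proof.
move=> ab hle ac; pose F0 := h \o clamp a b.
have acF c d : absc c d F0 by exact: absc_clamp.
have ndF : nondecreasing F0.
  move=> x y xy; have /andP[ax xb] := clamp_itv ab x.
  have /andP[ay yb] := clamp_itv ab y; apply: hle => //.
  by have /andP[] := clamp_lip a b xy.
have rcF : forall x, F0 @ at_right x --> F0 x.
  exact/right_continuousW/absc_continuous.
pose F : cumulative R R := HB.pack F0 (isCumulative.Build R _ R F0 ndF rcF).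
have mD : measurable (`]a, b]%classic : set (measurableTypeR R)).
  exact: measurable_itv.
pose ms : {measure set (measurableTypeR R) -> \bar R} := lebesgue_stieltjes_measure F.
have msE x y : x <= y -> ms `]x, y]%classic = (F y - F x)%:E.
  exact: stieltjes_itv_oc.
have Dfin : (ms `]a, b]%classic < +oo)%E by rewrite msE// ltry.
pose nu : {finite_measure set (measurableTypeR R) -> \bar R} := mfrestr mD Dfin.
have numu : nu `<< mu.
  apply/null_content_dominatesP => A mA A0; rewrite /nu/= /mfrestr /mrestr.
  (* The enlarged open interval contains []a, b]], the endpoint [b] included. *)
  apply: (@absc_stieltjes_dominates F (a - 1) (b + 1)) => //.
  - exact: measurableI.
  - by move=> x [_]/=; rewrite !in_itv/=; lra.
  - by apply: (subset_measure0 (mu := mu)) A0 => //; exact: measurableI.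
have [g [g0 gfin intg gE]] := radon_nikodym_sigma_finite numu.
have gEfin : EFin \o (fine \o g) = g by apply/funext => x /=; rewrite fineK.
exists (fine \o g); split.
- by move=> x; exact: fine_ge0.
- by rewrite gEfin.
- move=> x y ax xy yb; rewrite -Rintegral_itv_obnd_cbnd; last first.
    by rewrite gEfin; apply: integrableS intg.
  rewrite /Rintegral.
  under eq_integral do rewrite /= fineK//.
  rewrite -gE// /nu/= /mfrestr /mrestr setIidl; last first.
    by move=> t /=; rewrite !in_itv/=; lra.
  have -> : lebesgue_stieltjes_measure F `]x, y]%classic =
      (h (clamp a b y) - h (clamp a b x))%:E by exact: stieltjes_itv_oc.
  by rewrite /= !clamp_id//; lra.
Qed.

(** The density is [p - q], with [p] and [q] those of [P] and [N]. As [|p - q| <= p + q], its L1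
    norm is at most the growth of [P] plus that of [N], which is the total variation. *)
Lemma absc_density a b h : a <= b -> absc a b h ->
  exists g : R -> R, [/\ mu.-integrable setT (EFin \o g),
    forall x y, a <= x -> x <= y -> y <= b -> \int[mu]_(t in `[x, y]) g t = h y - h x &
    \int[mu]_(t in `[a, b]) `|g t| <= fine (total_variation a b h)].
Proof.
move=> ab ac; have [P [N [Ple Nle acP acN [hPN PNtv]]]] := absc_jordan ab ac.
have [p [p0 intp pE]] := monotone_absc_density ab Ple acP.
have [q [q0 intq qE]] := monotone_absc_density ab Nle acN.
have intpq : mu.-integrable setT (EFin \o (p \- q)).
  by rewrite (_ : _ \o _ = (EFin \o p) \- (EFin \o q))%E//; exact: integrableB.
have intS k (D : set R) : measurable D -> mu.-integrable setT (EFin \o k) ->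
    mu.-integrable D (EFin \o k).
  by move=> mD; apply: integrableS.
exists (p \- q); split => //.
- move=> x y ax xy yb; rewrite RintegralB//; [|exact: intS..].
  by rewrite pE// qE// hPN/=; ring.
- rewrite -PNtv -pE// -qE// -RintegralD//; [|exact: intS..].
  apply: le_Rintegral => //.
  + have := intS _ `[a, b]%classic (measurable_itv _) intpq.
    by move/integrable_abse.
  + rewrite (_ : _ \o _ = (EFin \o p) \+ (EFin \o q))%E//.
    by apply: integrableD => //; exact: intS.
  + move=> x _ /=; rewrite ler_norml.
    by have := p0 x; have := q0 x; lra.
Qed.

(** The difference quotients coincide, so this also holds where [F] is not derivable. *)
Lemma derive1_addc (F : R -> R) (s x : R) : derive1 (fun y => F y + s) x = derive1 F x.
Proof.
rewrite /derive1.
suff -> : (fun h : R => h^-1 *: (F (h + x) + s - (F x + s))) =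
  (fun h : R => h^-1 *: (F (h + x) - F x)) by [].
by apply/funext => h; congr (_ *: _); ring.
Qed.

(** Lebesgue's differentiation theorem for the primitive of [g] from [a], which agrees with [h] up
    to a constant near each interior point. *)
Lemma density_derivable a b h g : mu.-integrable setT (EFin \o g) ->
  (forall x y, a <= x -> x <= y -> y <= b -> \int[mu]_(t in `[x, y]) g t = h y - h x) ->
  {ae mu, forall x, a < x < b -> derivable h x 1 /\ derive1 h x = g x}.
Proof.
move=> intg gE.
have locg : locally_integrable setT g.
  by apply: open_integrable_locally => //; exact: openT.
have intga y : mu.-integrable `[a, y] (EFin \o g) by apply: integrableS intg.
have := @FTC1 R g (BLeft a) intga locg.
apply: filterS; first exact: (ae_filter_ringOfSetsType mu).
move=> x /=.
rewrite lte_fin => + /andP[ax xb] => /(_ ax)[dF Fx].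
pose F := fun x => \int[mu]_(t in `[a, x]) g t.
have nearF : \forall y \near x, F y + h a = h y.
  near=> y; rewrite /F gE ?subrK//.
    by apply/ltW; near: y; exact: open_gt.
  by apply/ltW; near: y; exact: open_lt.
have dFc : derivable (fun y => F y + h a) x 1.
  by apply: derivableD; [exact: dF|exact: derivable_cst].
split; first by apply: near_eq_derivable nearF _.
rewrite -Fx -(derive1_addc F (h a)) !derive1E; exact/esym/near_eq_derive.
Unshelve. all: by end_near. Qed.

End density.

(** * Integrals of almost everywhere equal functions *)

Section ae_eq_without_measurability.
Context {d} {T : measurableType d} {R : realType}.
Variable m : {measure set T -> \bar R}.
Local Open Scope ereal_scope.
Import HBNNSimple.

(** A simple function below [f], multiplied by the indicator of the complement of the null set [N],
    keeps its integral and lies below [g]. *)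
Let ge0_ae_le_integral_nonmeasurable (D : set T) (f g : T -> \bar R) :
  (forall x, D x -> 0 <= f x) -> (forall x, D x -> 0 <= g x) ->
  {ae m, forall x, D x -> f x = g x} -> \int[m]_(x in D) f x <= \int[m]_(x in D) g x.
Proof.
move=> f0 g0 [N [mN N0 sN]]; rewrite !ge0_integralE//.
apply: ge_ereal_sup => _ [h /= hf <-].
have mNC : measurable (~` N) by exact: measurableC.
pose h' := proj_nnsfun h mNC.
have -> : sintegral m h = sintegral m h'.
  rewrite -!integralT_nnsfun; apply: ae_eq_integral => //.
  - by apply/measurable_EFinP.
  - by apply/measurable_EFinP.
  - exists N; split => // x /=; apply: contra_notP => Nx _.
    by rewrite /h' /= mindicE mem_set ?mulr1.
apply: ereal_sup_ubound; exists h' => //= x.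
rewrite /h' /= mindicE; have [Nx|Nx] := pselect (N x).
  rewrite memNset ?mulr0; last by move=> /(_ Nx).
  by rewrite /patch; case: ifPn => // /set_mem /g0.
rewrite mem_set ?mulr1//; apply: le_trans (hf x) _.
rewrite /patch; case: ifPn => // /set_mem Dx.
suff -> : f x = g x by [].
by apply: contrapT => fg; apply: Nx; apply: sN => /(_ Dx).
Qed.

(* True without measurability because the integral of a nonnegative function is a
   supremum over the simple functions below it; this spares proving that the
   derivative of a continuous function, extended by a default value where it does
   not exist, is measurable. *)
Lemma ae_eq_integral_nonmeasurable (D : set T) (f g : T -> \bar R) :
  {ae m, forall x, D x -> f x = g x} -> \int[m]_(x in D) f x = \int[m]_(x in D) g x.
Proof.
move=> fg; rewrite integralE [RHS]integralE.
congr (_ - _); apply/eqP; rewrite eq_le; apply/andP;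
  split; apply: ge0_ae_le_integral_nonmeasurable => //.
- by apply: filterS fg => x /[apply]; rewrite !funeposE => ->.
- by apply: filterS fg => x /[apply]; rewrite !funeposE => ->.
- by apply: filterS fg => x /[apply]; rewrite !funenegE => ->.
- by apply: filterS fg => x /[apply]; rewrite !funenegE => ->.
Qed.

End ae_eq_without_measurability.

(** * Lifts of circle diffeomorphisms *)

Section lifts.
Context {R : realType}.
Notation mu := (@lebesgue_measure R).
Implicit Types (a b x y : R) (F G : R -> R) (g : circle R -> circle R).

Lemma toC_eqP x y : toC x = toC y <-> exists m : int, x = y + m%:~R.
Proof.
split=> [/eqP|[m ->]].
  by rewrite toC_eq => /intrP[m xy]; exists m; rewrite -xy addrC subrK.
by apply/eqP; rewrite toC_eq addrAC subrr add0r intr_int.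
Qed.

Lemma toC_addz x (m : int) : toC (x + m%:~R) = toC x.
Proof. by apply/toC_eqP; exists m. Qed.

Lemma repr_toC x : exists m : int, repr (toC x) = x + m%:~R.
Proof. by apply/toC_eqP; rewrite /toC reprK. Qed.

(** Two distinct values differ by at least 1, so the intermediate value theorem would produce the
    value [k x + 1/2], which is not an integer. The comparisons of lifts rest on this. *)
Lemma continuous_int_cst (k : R -> R) : continuous k ->
  (forall x, k x \is a Num.int) -> forall x y, k x = k y.
Proof.
move=> ck ik.
suff H x y : k x < k y -> False.
  by move=> x y; case: (ltgtP (k x) (k y)) => // /H.
move=> kxy; have [m km] := intrP (ik x); have [n kn] := intrP (ik y).
have kxy1 : k x + 1 <= k y.
  by move: kxy; rewrite km kn ltr_int -lezD1 -(ler_int R) intrD.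
have [c kc] : exists c, k c = k x + 2^-1.
  have [xy|/ltW yx] := leP x y.
    have [||c _ kc] := @IVT R k x y (k x + 2^-1) xy; last by exists c.
      exact: continuous_subspaceT.
    by rewrite min_l ?max_r ?ltW//; lra.
  have [||c _ kc] := @IVT R k y x (k x + 2^-1) yx; last by exists c.
    exact: continuous_subspaceT.
  by rewrite min_r ?max_l ?ltW//; lra.
have [p kp] := intrP (ik c).
have : (m < p)%R by rewrite -(ltr_int R) -km -kp kc; lra.
by rewrite -lezD1 -(ler_int R) intrD -km -kp kc; lra.
Qed.

Lemma is_lift_unique g F G : is_lift g F -> is_lift g G ->
  exists m : int, forall x, F x = G x + m%:~R.
Proof.
move=> [cF Fg] [cG Gg]; have iFG x : F x - G x \is a Num.int.
  by rewrite -toC_eq Fg Gg.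
have cFG : continuous (F \- G) by move=> x; apply: cvgB; [exact: cF|exact: cG].
have [m Em] := intrP (iFG 0); exists m => x.
by have /= E := continuous_int_cst cFG iFG 0 x; rewrite -Em E addrC subrK.
Qed.

(** An equality of difference quotients; it is also applied to [derive1 F], which need not be
    derivable everywhere. *)
Lemma derive1_translate F (t s : R) : (forall x, F (x + t) = F x + s) ->
  forall x, derive1 F (x + t) = derive1 F x.
Proof.
move=> Ft x; rewrite /derive1.
suff -> : (fun h : R => h^-1 *: (F (h + (x + t)) - F (x + t))) =
  (fun h => h^-1 *: (F (h + x) - F x)) by [].
by apply/funext => h; rewrite addrA !Ft; congr (_ *: _); ring.
Qed.

(** The iterates of [f] are bare functions on the circle, so the properties wanted of their lifts
    form a predicate stable under composition. *)
Record circle_lift g F : Prop := CircleLift {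
  clift_lift : is_lift g F;
  clift_add1 : forall x, F (x + 1) = F x + 1;
  clift_derivable : forall x, derivable F x 1;
  clift_derive_gt0 : forall x, 0 < derive1 F x;
  clift_derive_continuous : continuous (derive1 F) }.

(** A primitive of [F'' / F']: when it is absolutely continuous, its increments are the integrals
    over arcs and its total variation over a period is the distance to the identity. *)
Definition logder F x := ln (derive1 F x).

Section circle_lift_theory.
Variables (g : circle R -> circle R) (F : R -> R).
Hypothesis gF : circle_lift g F.

Lemma clift_continuous : continuous F.
Proof. by case: gF => -[]. Qed.

Lemma clift_MVT x y : x <= y ->
  exists2 c, x <= c <= y & F y - F x = derive1 F c * (y - x).
Proof.
move=> xy.
have [z _|//|c cxy ->] := @MVT_segment R F (derive1 F) x y xy.
  by have := @clift_derivable g F gF z => /derivableP; rewrite derive1E.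
  exact/continuous_subspaceT/clift_continuous.
by exists c => //; move: cxy; rewrite in_itv.
Qed.

Lemma clift_lt x y : x < y -> F x < F y.
Proof.
move=> xy; have [c _ FE] := clift_MVT (ltW xy).
by rewrite -subr_gt0 FE mulr_gt0 ?subr_gt0// (clift_derive_gt0 gF).
Qed.

Lemma clift_le x y : x <= y -> F x <= F y.
Proof. by rewrite le_eqVlt => /predU1P[->//|/clift_lt/ltW]. Qed.

Lemma clift_lipschitz a b : a <= b -> exists2 k, 0 <= k &
  forall x y, a <= x -> x <= y -> y <= b -> F y <= F x + k * (y - x).
Proof.
move=> ab.
have [|c cab cmax] := @EVT_max R (derive1 F) a b ab.
  exact/continuous_subspaceT/(clift_derive_continuous gF).
exists (derive1 F c); first exact/ltW/(clift_derive_gt0 gF).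
move=> x y ax xy yb; have [z zxy FE] := clift_MVT xy.
rewrite -lerBlDl FE ler_wpM2r ?subr_ge0//; apply: cmax.
by rewrite in_itv/=; lra.
Qed.

Lemma clift_addz x (m : int) : F (x + m%:~R) = F x + m%:~R.
Proof.
have Fn (n : nat) y : F (y + n%:R) = F y + n%:R.
  elim: n y => [|n IH] y; first by rewrite !addr0.
  by rewrite -natr1 addrA (clift_add1 gF) IH addrA.
case: m => n; first exact: Fn.
by rewrite NegzE mulrNz -[in RHS](subrK n.+1%:R x) Fn addrK.
Qed.

Lemma clift_derive_add1 x : derive1 F (x + 1) = derive1 F x.
Proof. exact/derive1_translate/(clift_add1 gF). Qed.

Lemma logder_add1 x : logder F (x + 1) = logder F x.
Proof. by rewrite /logder clift_derive_add1. Qed.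

Lemma expR_logder : expR \o logder F = derive1 F.
Proof. by apply/funext => x; rewrite /logder/= lnK// posrE (clift_derive_gt0 gF). Qed.

Lemma clift_image_carc a b : a <= b -> g @` carc a b = carc (F a) (F b).
Proof.
move=> ab; have Fg := (clift_lift gF).2.
apply/seteqP; split=> [_ [_ [x xab <-] <-]|_ [y yab <-]].
  rewrite -Fg; exists (F x) => //; move: xab; rewrite /= !in_itv/= => /andP[ax xb].
  by rewrite !clift_le.
have [|x xab Fx] := @IVT R F a b y ab (continuous_subspaceT clift_continuous).
  by move: yab; rewrite /= in_itv/= min_l ?max_r// clift_le.
by exists (toC x); [exists x|rewrite -Fg Fx].
Qed.

(** The lift chosen in [cderiv] differs from [F] by an integer constant and [repr] moves [x] by an
    integer; neither changes the derivative. *)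
Lemma cderiv_lift x : cderiv g (toC x) = derive1 F x.
Proof.
have cl : is_lift g (clift g).
  apply: (@xgetPex _ (id : R -> R) [set F | is_lift g F]).
  by exists F; exact: clift_lift.
have [m Em] := is_lift_unique cl (clift_lift gF).
have [n En] := repr_toC x.
rewrite /cderiv En (_ : clift g = fun y => F y + m%:~R); last exact/funext.
by rewrite derive1_addc; apply: derive1_translate => y; rewrite clift_addz.
Qed.

Lemma cderiv2_lift x : cderiv2 g (toC x) = derive1 (derive1 F) x.
Proof.
rewrite /cderiv2 (_ : (fun y : R => _) = derive1 F); last exact/funext/cderiv_lift.
have [n ->] := repr_toC x.
apply: (@derive1_translate _ _ 0) => y.
by rewrite addr0 (periodic_intr clift_derive_add1).
Qed.

End circle_lift_theory.

Lemma circle_lift_id : circle_lift id (id : R -> R).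
Proof.
have d1 : derive1 (id : R -> R) = cst 1.
  by apply/funext => x; rewrite derive1E derive_id.
split => //.
- by split => // x; exact: cvg_id.
- by move=> x; rewrite d1.
- by rewrite d1 => x; exact: cvg_cst.
Qed.

(** The image of a subdivision is a subdivision, strictly increasing because [phi] is. *)
Lemma total_variation_comp (phi h : R -> R) a b :
  (forall x y, x < y -> phi x < phi y) ->
  (total_variation a b (h \o phi) <= total_variation (phi a) (phi b) h)%E.
Proof.
move=> phi_lt; apply: ge_ereal_sup => _ [_ [l [pl /eqP lastl] <-] <-].
have -> : variation a b (h \o phi) l = variation (phi a) (phi b) h [seq phi x | x <- l].
  rewrite !variation_steps /incr_sum.
  have -> : steps (phi a) [seq phi x | x <- l] =
      [seq (phi p.1, phi p.2) | p <- steps a l].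
    by rewrite /steps; elim: l {pl lastl} a => //= x l IH a; rewrite IH.
  by rewrite big_map.
apply: ereal_sup_ubound => /=.
exists (variation (phi a) (phi b) h [seq phi x | x <- l]) => //.
apply: variations_variation; split; last by rewrite last_map lastl.
by rewrite path_map; apply: sub_path pl => x y /phi_lt.
Qed.

(** An integer translation brings [c] to [r] in [[0, 1]]; the variation over [[1, r + 1]] is then at
    most that over [[0, r]]. *)
Lemma total_variation_periodic (h : R -> R) c : (forall x, h (x + 1) = h x) ->
  (total_variation c (c + 1) h <= total_variation 0 1 h)%E.
Proof.
move=> h1; pose m := Num.floor c; pose r := c - m%:~R.
have [r0 r1] : 0 <= r /\ r <= 1.
  have := floor_itv c; rewrite -/m intrD mulr1z /r; lra.
have shift (p : int) x y : (total_variation x y h <=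
    total_variation (x + p%:~R) (y + p%:~R) h)%E.
  have {1}-> : h = h \o (fun z => z + p%:~R).
    by apply/funext => z /=; rewrite periodic_intr.
  by apply: total_variation_comp => u v; rewrite ltrD2r.
apply: le_trans (shift (- m) _ _) _; rewrite mulrNz addrAC -/r.
rewrite (total_variationD h r1) ?lerDr//.
rewrite (total_variationD h r0 r1) addeC leeD2r//.
by have := shift (-1) 1 (r + 1); rewrite mulrNz subrr addrK.
Qed.

(** * Composition of lifts and the cocycle relation *)

Section comp.
Variables (g1 g2 : circle R -> circle R) (F1 F2 : R -> R).
Hypotheses (gF1 : circle_lift g1 F1) (gF2 : circle_lift g2 F2).

Lemma derive1_lift_comp x :
  derive1 (F1 \o F2) x = derive1 F1 (F2 x) * derive1 F2 x.
Proof.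
by rewrite derive1_comp//; [exact: clift_derivable gF2 _|exact: clift_derivable gF1 _].
Qed.

Lemma circle_lift_comp : circle_lift (g1 \o g2) (F1 \o F2).
Proof.
split.
- split=> [|x] /=; last by rewrite (clift_lift gF1).2 (clift_lift gF2).2.
  move=> x; apply: continuous_comp; [exact: clift_continuous gF2 _|].
  exact: clift_continuous gF1 _.
- by move=> x /=; rewrite (clift_add1 gF2) (clift_add1 gF1).
- move=> x; apply/derivable1_diffP/differentiable_comp.
    exact/derivable1_diffP/(clift_derivable gF2).
  exact/derivable1_diffP/(clift_derivable gF1).
- move=> x; rewrite derive1_lift_comp mulr_gt0//.
    exact: clift_derive_gt0 gF1 _.
  exact: clift_derive_gt0 gF2 _.
- rewrite (_ : derive1 _ = fun x => derive1 F1 (F2 x) * derive1 F2 x); last first.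
    exact/funext/derive1_lift_comp.
  move=> x; apply: cvgM; last exact: clift_derive_continuous gF2 _.
  apply: (@continuous_comp _ _ _ F2 (derive1 F1)); first exact: clift_continuous gF2 _.
  exact: clift_derive_continuous gF1 _.
Qed.

Lemma logder_comp : logder (F1 \o F2) = (logder F1 \o F2) \+ logder F2.
Proof.
apply/funext => x; rewrite /logder derive1_lift_comp/= lnM// posrE.
  exact: clift_derive_gt0 gF1 _.
exact: clift_derive_gt0 gF2 _.
Qed.

(** [F2] is Lipschitz on [[0, 1]] and maps it to [[F2 0, F2 0 + 1]], a period of [logder F1]. *)
Lemma absc_logder_comp : absc 0 1 (logder F1) -> absc 0 1 (logder F2) ->
  absc 0 1 (logder (F1 \o F2)).
Proof.
move=> ac1 ac2; rewrite logder_comp; apply: abscD ac2.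
have [k k0 Fk] := clift_lipschitz gF2 (@ler01 R).
have ac1' := absc_periodic (logder_add1 gF1) ac1 (F2 0).
apply: (absc_comp k0 _ _ ac1') => [x /andP[x0 x1]|x y x0 xy y1].
  rewrite -(clift_add1 gF2) add0r.
  by apply/andP; split; apply: clift_le gF2 _ _ _.
by rewrite (clift_le gF2 xy) Fk.
Qed.

(** The source of the subadditivity of [d(f^n, e)]: the cocycle relation, and the fact that [F2]
    maps a period to a period. *)
Lemma total_variation_logder_comp :
  (total_variation 0 1 (logder (F1 \o F2)) <=
   total_variation 0 1 (logder F1) + total_variation 0 1 (logder F2))%E.
Proof.
rewrite logder_comp; apply: le_trans (total_variation_le _ _ ler01) _.
apply: (leeD _ (lexx _)).
apply: le_trans (total_variation_comp _ _ _ (@clift_lt _ _ gF2)) _.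
rewrite -[X in total_variation _ (F2 X)]add0r (clift_add1 gF2).
by apply: total_variation_periodic; exact: logder_add1 gF1.
Qed.

End comp.

(** From [ln (x / y) <= x / y - 1] comes [ln x - ln y <= (x - y) / y], where [y >= r]. *)
Lemma ln_lipschitz (r u v : R) : 0 < r -> r <= u -> r <= v ->
  `|ln u - ln v| <= r^-1 * `|u - v|.
Proof.
move=> r0.
have key x y : r <= x -> r <= y -> ln x - ln y <= r^-1 * `|x - y|.
  move=> rx ry; have [x0 y0] : 0 < x /\ 0 < y by lra.
  rewrite -ln_div ?posrE//; have -> : x / y = 1 + (x - y) / y by field; lra.
  apply: le_trans (le_ln1Dx _) _.
    have -> : (x - y) / y = x / y - 1 by field; lra.
    by have := divr_gt0 x0 y0; lra.
  rewrite mulrC; apply: (@le_trans _ _ (y^-1 * `|x - y|)).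
    by apply: ler_wpM2l; [rewrite invr_ge0 ltW|exact: ler_norm].
  by rewrite ler_wpM2r// lef_pV2.
move=> ru rv; rewrite ler_norml; apply/andP; split; last exact: key.
by have := key _ _ rv ru; rewrite distrC; lra.
Qed.

(** On [[0, 1]] the derivative has a positive minimum, above which [ln] is Lipschitz. *)
Lemma absc_logder g F : circle_lift g F -> absc 0 1 (derive1 F) -> absc 0 1 (logder F).
Proof.
move=> gF; have [|c c01 cmin] := @EVT_min R (derive1 F) 0 1 ler01.
  exact/continuous_subspaceT/(clift_derive_continuous gF).
have c0 := clift_derive_gt0 gF c.
apply: (@absc_post _ _ _ (derive1 F c)^-1 (derive1 F) (@ln R)).
  by rewrite invr_gt0.
by move=> x y x01 y01; apply: ln_lipschitz => //; apply: cmin; rewrite in_itv.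
Qed.

(** The fields of [diff1AC] provide unrelated lifts; they are reconciled by observing that each
    discrepancy is continuous and integer-valued, hence constant. *)
Lemma diff1AC_lift (f : diff1AC R) : exists F G,
  [/\ circle_lift f F, absc 0 1 (logder F), cancel F G & cancel G F].
Proof.
have [F [Flift dF cF']] := dfun_C1 f.
have [G0 [G0lift dG0 _]] := dinv_C1 f.
have [F1 F1lift F1lt] := dfun_orient f.
have [m Fm] := is_lift_unique Flift F1lift.
have Flt x y : x < y -> F x < F y by move=> /F1lt; rewrite !Fm ltrD2r.
have [cF Ff] := Flift; have [cG0 G0f] := G0lift.
have cG0F : continuous (fun x => G0 (F x) - x).
  move=> x; apply: cvgB; last exact: cvg_id.
  by apply: continuous_comp; [exact: cF|exact: cG0].
have iG0F x : G0 (F x) - x \is a Num.int by rewrite -toC_eq G0f Ff dfunK.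
have [n En] := intrP (iG0F 0).
(* [G0 (F x) - x] is the constant [n], which the shift cancels. *)
pose G x := G0 x + (- n)%:~R.
have FK : cancel F G.
  move=> x; have := continuous_int_cst cG0F iG0F x 0; rewrite En /G mulrNz; lra.
have Glift : is_lift (Defs.dinv f) G.
  split=> [x|x]; last by rewrite /G toC_addz G0f.
  by apply: cvgD; [exact: cG0|exact: cvg_cst].
have cG : continuous G := Glift.1.
(* [F (G x) - x] is constant and vanishes at [F 0]. *)
have GK : cancel G F.
  have cFG : continuous (fun x => F (G x) - x).
    move=> x; apply: cvgB; last exact: cvg_id.
    by apply: continuous_comp; [exact: cG|exact: cF].
  have iFG x : F (G x) - x \is a Num.int by rewrite -toC_eq Ff Glift.2 dinvK.
  by move=> x; have := continuous_int_cst cFG iFG x (F 0); rewrite FK; lra.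
(* [F (x + 1) - F x] is a constant positive integer, so [F] takes the value [F 0 + 1] at some [c] in
   [[0, 1]]. Applying the inverse of [f] shows that [c] and 0 are the same point of the circle; thus
   [c] is an integer other than 0, hence 1. *)
have Fadd1 x : F (x + 1) = F x + 1.
  have cF1 : continuous (fun x => F (x + 1) - F x).
    move=> y; apply: cvgB; last exact: cF.
    apply: (@continuous_comp _ _ _ (fun y => y + 1) F); last exact: cF.
    by apply: cvgD; [exact: cvg_id|exact: cvg_cst].
  have iF1 y : F (y + 1) - F y \is a Num.int.
    by rewrite -toC_eq !Ff; apply/eqP; congr (f _); exact: (toC_addz y 1).
  have [p Ep] := intrP (iF1 0); rewrite add0r in Ep.
  have p0 : 0 < (p%:~R : R) by rewrite -Ep subr_gt0 Flt.
  have p1 : 1 <= (p%:~R : R).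
    by move: p0; rewrite ltr0z gtz0_ge1 -(ler_int R).
  have [|c c01 Fc] := @IVT R F 0 1 (F 0 + 1) ler01 (continuous_subspaceT cF).
    by rewrite min_l ?max_r ?(ltW (Flt _ _ ltr01))//; lra.
  have /toC_eqP[q Eq] : toC c = toC 0.
    rewrite -[c]FK Fc Glift.2; have -> := toC_addz (F 0) 1.
    by rewrite -Glift.2 FK.
  rewrite add0r in Eq; move: c01; rewrite in_itv/= Eq => /andP[q0 q1].
  have qn0 : q != 0.
    by apply/eqP => q00; move: Fc; rewrite Eq q00; lra.
  have q1' : q = 1.
    by apply/eqP; rewrite eq_le -(ler_int R) q1 -gtz0_ge1 lt_def qn0 -(ler_int R).
  move: Fc; rewrite Eq q1' => F01.
  by have /= := continuous_int_cst cF1 iF1 x 0; rewrite add0r F01; lra.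
(* Nonnegative by monotonicity, nonzero by the chain rule since [G0 \o F] has derivative 1. *)
have F'gt0 x : 0 < derive1 F x.
  rewrite lt_def; apply/andP; split.
    have dGF : derive1 (G0 \o F) x = 1.
      rewrite (_ : _ \o _ = fun y => y + n%:~R); last first.
        apply/funext => y; have := FK y; rewrite /G/= mulrNz; lra.
      by rewrite derive1_addc derive1E derive_id.
    apply/eqP => F'0; have := derive1_comp (dF x) (dG0 (F x)).
    by rewrite dGF F'0 mulr0 => /eqP; rewrite oner_eq0.
  apply: (@incr_derive1_ge0 R F setT) => //.
  - by move=> u v _ _; exact: Flt.
  - by rewrite interiorT.
have FL : circle_lift f F by exact: CircleLift Flift Fadd1 dF F'gt0 cF'.
exists F, G; split => //; apply: (absc_logder FL).
have := abs_continuous_absc (dfun_AC f).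
by rewrite (_ : (fun x => _) = derive1 F)//; apply/funext => x; exact: cderiv_lift FL x.
Qed.

End lifts.

(** * Subadditive sequences and two-sided sums *)

Section subadditive.
Context {R : realType}.

(** The limit is the infimum of [d n / n] over [n >= 1]. If [m] nearly attains it, Euclidean
    division of [n] by [m] bounds [d n] by [n] times [d m / m], plus a constant [M]. *)
Lemma fekete (d : nat -> R) : (forall n, 0 <= d n) ->
  (forall m n, d (m + n)%N <= d m + d n) -> cvgn (fun n => d n / n%:R).
Proof.
move=> d0 dD.
(* The index starts at 1, because [d 0 / 0] is 0 by convention. *)
pose E := [set d n.+1 / n.+1%:R | n in [set: nat]].
have Elb x : E x -> 0 <= x by move=> [n _ <-]; rewrite divr_ge0.
have hE : has_inf E by split; [exists (d 1%N / 1%:R), 0%N|exists 0].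
apply/cvg_ex; exists (inf E); apply/cvgrPdist_le => e e0.
have [_ [m' _ <-] dm] := inf_adherent (ltac:(lra) : 0 < e / 2) hE.
set m := m'.+1 in dm.
have dq q : d (q * m)%N <= q%:R * d m + d 0%N.
  elim: q => [|q IH]; first by rewrite mul0n mul0r add0r.
  by rewrite mulSn -natr1 mulrDl mul1r; apply: le_trans (dD _ _) _; lra.
(* [d 0] comes from [dq], whose case [q = 0] requires it; the sum bounds [d r] for every remainder
   [r < m]. *)
pose M := d 0%N + \sum_(r < m) d r.
have dM n : d n <= n%:R * (d m / m%:R) + M.
  rewrite {1}(divn_eq n m); apply: le_trans (dD _ _) _.
  rewrite /M addrA; apply: lerD; last first.
    have rm : (n %% m < m)%N by rewrite ltn_mod.
    by rewrite (bigD1 (Ordinal rm))//= lerDl sumr_ge0.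
  apply: le_trans (dq _) _; rewrite lerD2r mulrA mulrAC ler_wpM2r//.
  by rewrite ler_pdivlMr ?ltr0n// -natrM ler_nat leq_divM.
have M0 : 0 <= M by rewrite addr_ge0 ?sumr_ge0.
exists (Num.bound (M / (e / 2))).+1 => // n /= Mn.
have n0 : 0 < n%:R :> R by rewrite ltr0n (leq_trans _ Mn).
have Mn' : M / n%:R <= e / 2.
  rewrite ler_pdivrMr// mulrC -ler_pdivrMr; last lra.
  apply/ltW/(lt_le_trans (archi_boundP _)); first by rewrite divr_ge0//; lra.
  by rewrite ler_nat ltnW.
have infn : inf E <= d n / n%:R.
  apply: ge_inf; first by exists 0.
  by exists n.-1 => //; rewrite prednK//; rewrite -(ltr0n R).
rewrite distrC ger0_norm ?subr_ge0//.
suff : d n / n%:R <= d m / m%:R + M / n%:R by move: dm; lra.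
rewrite ler_pdivrMr// mulrDl divfK ?gt_eqF//.
by apply: le_trans (dM n) _; rewrite mulrC.
Qed.

Lemma limn_div_ge (d : nat -> R) (L : R) : cvgn (fun n => d n / n%:R) ->
  (forall n, n%:R * L <= d n) -> L <= limn (fun n => d n / n%:R).
Proof.
move=> cd Ld; apply: limr_ge => //; exists 1%N => // n /= n1.
by rewrite ler_pdivlMr ?ltr0n// mulrC.
Qed.

End subadditive.

Section two_sided_sums.
Context {R : realType}.
Implicit Types u v c : int -> R.

Definition zsum_cvg u :=
  cvgn (series (fun n => u (Posz n))) /\ cvgn (series (fun n => u (Negz n))).

Lemma zsumD u v : zsum_cvg u -> zsum_cvg v ->
  zsum_cvg (u \+ v) /\ zsum (u \+ v) = zsum u + zsum v.
Proof.
move=> [up un] [vp vn].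
have sD (e : nat -> int) : series (fun n => (u \+ v) (e n)) =
    series (fun n => u (e n)) \+ series (fun n => v (e n)).
  by apply/funext => n; rewrite /series/= big_split.
rewrite /zsum_cvg /zsum !sD; split; first by split; apply: is_cvgD.
by rewrite !limD//; ring.
Qed.

(** The term [u 0] passes from the half indexed by [Posz] to the half indexed by [Negz]. *)
Lemma zsum_shift u : zsum_cvg u ->
  zsum_cvg (fun i => u (i + 1)) /\ zsum (fun i => u (i + 1)) = zsum u.
Proof.
move=> [up un]; rewrite /zsum_cvg /zsum.
have pE : series (fun n => u (Posz n + 1)) =
    (fun n => series (fun n => u (Posz n)) n.+1 - u 0).
  apply/funext => n; rewrite /series/= big_nat_recl//= addrAC subrr add0r.
  by apply: eq_bigr => i _; congr u; lia.
have nE : [sequence series (fun n => u (Negz n + 1)) n.+1]_n =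
    (fun n => series (fun n => u (Negz n)) n + u 0).
  apply/funext => n; rewrite /series/= big_nat_recl//= addrC; congr (_ + _).
  by apply: eq_bigr => i _; congr u; lia.
have cp : series (fun n => u (Posz n + 1)) @ \oo -->
    limn (series (fun n => u (Posz n))) - u 0.
  rewrite pE; apply: cvgB; last exact: cvg_cst.
  by rewrite (cvg_shiftS (series _)).
have cn : series (fun n => u (Negz n + 1)) @ \oo -->
    limn (series (fun n => u (Negz n))) + u 0.
  by rewrite -(cvg_shiftS (series _)) nE; apply: cvgD; last exact: cvg_cst.
split; first by split; apply/cvg_ex; eexists; eassumption.
by rewrite (cvg_lim _ cp)// (cvg_lim _ cn)//; ring.
Qed.

Lemma zsum_cvg_bounded c (M : R) :
  (forall s : seq int, uniq s -> \sum_(i <- s) `|c i| <= M) -> zsum_cvg c.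
Proof.
move=> cM.
have key (e : nat -> int) : injective e -> cvgn (series (fun n => c (e n))).
  move=> einj; apply: normed_cvg; apply: nondecreasing_is_cvgn.
    apply: (@nondecreasing_series _ (fun n => `|c (e n)|) xpredT 0%N).
    by move=> i _ _; exact: normr_ge0.
  exists M => _ [n _ <-]; rewrite /series/=.
  have := cM [seq e i | i <- index_iota 0 n].
  by rewrite big_map; apply; rewrite map_inj_uniq ?iota_uniq.
by split; apply: key => i j [].
Qed.

Lemma zsum_cvg0 : zsum_cvg (fun=> 0 : R) /\ zsum (fun=> 0 : R) = 0.
Proof.
have cv : zsum_cvg (fun=> 0 : R).
  by apply: (@zsum_cvg_bounded _ 0) => s _; rewrite big1// => i _; rewrite normr0.
have s0 : series (fun _ : nat => 0 : R) = cst 0.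
  by apply/funext => n; rewrite /series/= big1.
by split=> //; rewrite /zsum s0 lim_cst// addr0.
Qed.

(** Each of the [n] shifts of [c] has the same sum as [c]; the factor [n] of the final bound arises
    here. *)
Lemma zsum_window c (n : nat) : zsum_cvg c ->
  zsum_cvg (fun k => \sum_(j < n) c (k + j)) /\
  zsum (fun k => \sum_(j < n) c (k + j)) = n%:R * zsum c.
Proof.
move=> cc.
have shift j : zsum_cvg (fun k => c (k + Posz j)) /\
    zsum (fun k => c (k + Posz j)) = zsum c.
  elim: j => [|j [IH1 IH2]].
    by rewrite (_ : (fun k => _) = c)//; apply/funext => k; rewrite addr0.
  have [] := zsum_shift IH1; rewrite IH2.
  rewrite (_ : (fun i => _) = (fun k => c (k + Posz j.+1)))//.
  by apply/funext => k; congr c; lia.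
elim: n => [|n [IH1 IH2]].
  rewrite mul0r (_ : (fun k => _) = fun=> 0); first exact: zsum_cvg0.
  by apply/funext => k; rewrite big_ord0.
have [s1 s2] := shift n; have [] := zsumD IH1 s1.
rewrite IH2 s2 (_ : _ \+ _ = fun k : int => \sum_(j < n.+1) c (k + Posz j)).
  by rewrite -natr1 mulrDl mul1r.
by apply/funext => k; rewrite big_ord_recr.
Qed.

(** The partial sums of [n] terms of the two halves together form the sum over the integers from
    [-n] to [n - 1]. *)
Lemma zsum_le u (M : R) : zsum_cvg u ->
  (forall s : seq int, uniq s -> `|\sum_(i <- s) u i| <= M) -> `|zsum u| <= M.
Proof.
move=> [up un] uM; rewrite /zsum -limD// -lim_norm; last exact: is_cvgD.
apply: limr_le; first by apply: is_cvg_norm; exact: is_cvgD.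
apply: nearW => n.
have := uM ([seq Posz i | i <- index_iota 0 n] ++ [seq Negz i | i <- index_iota 0 n]).
rewrite big_cat !big_map; apply; rewrite cat_uniq !map_inj_uniq ?iota_uniq//=.
- by rewrite andbT; apply/hasPn => _ /mapP[i _ ->]; apply/mapP => -[].
- by move=> i j [].
- by move=> i j [].
Qed.

Lemma summable_bounded c (M : R) :
  (forall s : seq int, uniq s -> \sum_(i <- s) `|c i| <= M) ->
  summable [set: int] (fun i => (c i)%:E).
Proof.
move=> cM; apply: le_lt_trans (ltry M); apply: ge_ereal_sup => _ [A [fA _] <-].
rewrite fsbig_finite//=.
by rewrite sumEFin lee_fin; apply: cM; exact: finmap.fset_uniq.
Qed.

End two_sided_sums.

(** * Integrals over arcs of the circle *)

Section lift_density.
Context {R : realType}.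
Notation mu := (@lebesgue_measure R).
Implicit Types (a b x y : R) (F : R -> R) (h : R -> R) (g : circle R -> circle R).

Lemma integrableTS (p : R -> R) (D : set R) : measurable D ->
  mu.-integrable setT (EFin \o p) -> mu.-integrable D (EFin \o p).
Proof. by move=> mD; apply: integrableS. Qed.

(** Turns the bound of [absc_density] into an equality. The increments of [h] are dominated by those
    of the primitive [P] of [|p|], whose variation over any subdivision is [P b - P a]. *)
Lemma total_variation_le_density a b h p : a <= b -> mu.-integrable setT (EFin \o p) ->
  (forall x y, a <= x -> x <= y -> y <= b -> \int[mu]_(t in `[x, y]) p t = h y - h x) ->
  (total_variation a b h <= (\int[mu]_(t in `[a, b]) `|p t|)%:E)%E.
Proof.
move=> ab intp pE; pose P x := \int[mu]_(t in `[a, x]) `|p t|.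
have intn : mu.-integrable setT (EFin \o (fun x => `|p x|)) by exact: integrable_norm.
have PB x y : a <= x -> x <= y -> P y - P x = \int[mu]_(t in `]x, y]) `|p t|.
  move=> ax xy.
  by apply: (@Rintegral_itvB R (fun x => `|p x|) (BLeft a) (BRight y) x);
    rewrite ?bnd_simp//; exact: (@integrableTS (fun x => `|p x|)).
have hP x y : a <= x -> x <= y -> y <= b -> `|h y - h x| <= P y - P x.
  move=> ax xy yb; rewrite PB// -pE//.
  rewrite -Rintegral_itv_obnd_cbnd; last exact: integrableTS.
  by apply: le_normr_Rintegral => //; exact: integrableTS.
have PaE : P a = 0 by rewrite /P set_itv1 Rintegral_set1.
rewrite -/(P b); apply: ge_ereal_sup => _ [_ [l [pl /eqP lastl] <-] <-].
rewrite lee_fin -[leRHS]subr0 -PaE.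
have ndP : {in `[a, b] &, nondecreasing_fun P}.
  move=> x y; rewrite !in_itv/= => /andP[ax _] _ xy.
  by rewrite -subr_ge0 PB//; apply: Rintegral_ge0.
rewrite -(nondecreasing_variation (s := l) ndP); last by split; rewrite ?lastl.
rewrite !variation_steps /incr_sum big_seq [leRHS]big_seq; apply: ler_sum => q qs.
have [/andP[/allP/(_ q qs)/and3P[aq qq]]] := subitvs_steps pl.
rewrite lastl => qb _ _; apply: le_trans (hP _ _ aq qq qb) _; exact: ler_norm.
Qed.

(** As [F' = exp (logder F)], the density [p] of [logder F] is [F'' / F'] almost everywhere. *)
Lemma circle_lift_density g F : circle_lift g F -> absc 0 1 (logder F) ->
  exists p : R -> R, [/\ mu.-integrable setT (EFin \o p),
    forall x y, 0 <= x -> x <= y -> y <= 1 ->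
      \int[mu]_(t in `[x, y]) p t = logder F y - logder F x,
    {ae mu, forall x, `[0, 1[%classic x ->
      cderiv2 g (toC x) / cderiv g (toC x) = p x} &
    \int[mu]_(t in `[0, 1]) `|p t| = fine (total_variation 0 1 (logder F))].
Proof.
move=> gF ac; have [p [intp pE ptv]] := absc_density ler01 ac.
exists p; split => //; last first.
  have tvle := total_variation_le_density ler01 intp pE.
  apply/eqP; rewrite eq_le ptv/= -lee_fin fineK//.
  by apply/bounded_variationP => //; exact: absc_bounded_variation.
(* The endpoint 0 is discarded, since derivability is obtained only inside the interval. *)
have ne0 : {ae mu, forall x : R, x != 0}.
  exists [set 0]; split => //; first exact: lebesgue_measure_set1.
  by move=> x /= /negP; rewrite negbK => /eqP.
have := density_derivable intp pE.
apply: filterS2 ne0; first exact: (ae_filter_ringOfSetsType mu).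
move=> x x0 dx /=; rewrite in_itv/= => /andP[x0' x1].
have [dl lE] := dx ltac:(by rewrite x1 andbT lt_neqAle eq_sym x0).
rewrite (cderiv2_lift gF) (cderiv_lift gF) -(expR_logder gF).
rewrite derive1_comp; [|exact: dl|exact: derivable_expR].
have -> : derive1 expR (logder F x) = expR (logder F x).
  by rewrite derive1E; exact: derive_val.
by rewrite lE/= mulrAC divff ?mul1r// gt_eqF// expR_gt0.
Qed.

Lemma cdist_id_lift g F : circle_lift g F -> absc 0 1 (logder F) ->
  cdist g id = fine (total_variation 0 1 (logder F)).
Proof.
move=> gF ac; have [p [intp _ gp <-]] := circle_lift_density gF ac.
rewrite -Rintegral_itv_bndo_bndc; last first.
  by apply: (@integrableTS (fun x => `|p x|)) => //; exact: integrable_norm.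
rewrite /cdist /cintegral preimage_setT setIT /Rintegral; congr fine.
apply: ae_eq_integral_nonmeasurable; move: gp; apply: filterS.
  exact: (ae_filter_ringOfSetsType mu).
move=> x /= gp x01; rewrite (gp x01); congr (`|_|%:E).
rewrite (cderiv2_lift circle_lift_id) (_ : derive1 id = cst 1); last first.
  by apply/funext => y; rewrite derive1E derive_id.
by rewrite derive1_cst mul0r subr0.
Qed.

(** The domain over which [cintegral] integrates for an arc. *)
Definition fund_carc a b : set R := `[0, 1[ `&` toC @^-1` carc a b.

Lemma carc_addz a b (m : int) : carc (a + m%:~R) (b + m%:~R) = carc a b.
Proof.
apply/seteqP; split=> _ [x xab <-].
  exists (x + (- m)%:~R); last exact: toC_addz.
  by move: xab; rewrite /= !in_itv/= mulrNz; lra.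
exists (x + m%:~R); last exact: toC_addz.
by move: xab; rewrite /= !in_itv/=; lra.
Qed.

Lemma intr_itv0 (m : int) : -1 < (m%:~R : R) < 1 -> m = 0.
Proof.
move=> /andP[m1 m2]; have : (-1 < m)%R && (m < 1)%R by rewrite -!(ltr_int R) m1.
by lia.
Qed.

Lemma fund_carc_small a b : 0 <= a -> b < 1 -> fund_carc a b = `[a, b]%classic.
Proof.
move=> a0 b1; apply/seteqP; split=> [y [/=]|y yab]; last first.
  by split; [move: yab; rewrite /= !in_itv/=; lra|exists y].
rewrite in_itv/= => y01 [x]; rewrite /= !in_itv/= => xab /toC_eqP[m xm].
have m0 : m = 0 by apply: intr_itv0; lra.
by move: xm; rewrite m0 addr0 => <-.
Qed.

Lemma fund_carc_wrap a b : a < 1 -> 1 <= b -> b < a + 1 ->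
  fund_carc a b = `[a, 1[%classic `|` `[0, b - 1]%classic.
Proof.
move=> a1 b1 ba; apply/seteqP; split=> [y [/=]|y [|]]/=; rewrite ?in_itv/=.
- move=> y01 [x]; rewrite /= !in_itv/= => xab /toC_eqP[m xm].
  have [x1|x1] := ltP x 1.
    have m0 : m = 0 by apply: intr_itv0; lra.
    by left; move: xm; rewrite m0 addr0 => <-; lra.
  have m1 : m - 1 = 0 by apply: intr_itv0; rewrite intrB; lra.
  have {}m1 : m = 1 by lia.
  by right; move: xm; rewrite m1; lra.
- move=> yab; split; first by rewrite /= in_itv/=; lra.
  by exists y => //; rewrite /= in_itv/=; lra.
- move=> yb; split; first by rewrite /= in_itv/=; lra.
  by exists (y + 1); [rewrite /= in_itv/=; lra|exact: (toC_addz y 1)].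
Qed.

Lemma fund_carc_translate a b : exists m : int, 0 <= a + m%:~R < 1 /\
  fund_carc a b = fund_carc (a + m%:~R) (b + m%:~R).
Proof.
exists (- Num.floor a); rewrite /fund_carc carc_addz; split=> //.
by have := floor_itv a; rewrite intrD mulrNz; lra.
Qed.

Lemma measurable_fund_carc a b : a <= b -> b < a + 1 -> measurable (fund_carc a b).
Proof.
move=> ab ba; have [m [am ->]] := fund_carc_translate a b.
have [b1|b1] := ltP (b + m%:~R) 1; first by rewrite fund_carc_small//; lra.
rewrite fund_carc_wrap//; [|lra..].
exact: measurableU.
Qed.

(** With [a] translated into [[0, 1)], an arc through the point 0 has two pieces; they give
    [(h 1 - h a) + (h (b - 1) - h 0)], which is [h b - h a] by periodicity. *)
Lemma Rintegral_fund_carc a b h p : a <= b -> b < a + 1 ->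
  (forall x, h (x + 1) = h x) -> mu.-integrable setT (EFin \o p) ->
  (forall x y, 0 <= x -> x <= y -> y <= 1 -> \int[mu]_(t in `[x, y]) p t = h y - h x) ->
  \int[mu]_(t in fund_carc a b) p t = h b - h a.
Proof.
move=> ab ba h1 intp pE; have [m [am ->]] := fund_carc_translate a b.
rewrite -(periodic_intr h1 m a) -(periodic_intr h1 m b).
suff H a' b' : 0 <= a' < 1 -> a' <= b' -> b' < a' + 1 ->
    \int[mu]_(t in fund_carc a' b') p t = h b' - h a' by apply: H => //; lra.
move=> {}am {}ab {}ba; have [b1|b1] := ltP b' 1.
  by rewrite fund_carc_small; [rewrite pE|..]; lra.
rewrite fund_carc_wrap; [|lra..].
rewrite Rintegral_setU//.
- rewrite Rintegral_itv_bndo_bndc; last exact: integrableTS.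
  rewrite !pE; [|lra..].
  by have := h1 0; have := h1 (b' - 1); rewrite add0r subrK => -> ->; ring.
- by apply: integrableTS => //; exact: measurableU.
- by apply/disj_setPS => y [/=]; rewrite !in_itv/=; lra.
Qed.

(** The disjointness of the arcs enters here: the integrals of [|p|] over the [D i] add up to an
    integral over part of one period. *)
Lemma sum_norm_Rintegral_le (T : choiceType) (D : T -> set R) (s : seq T) p :
  (forall i, measurable (D i)) -> trivIset setT D -> uniq s ->
  (forall i, D i `<=` `[0, 1[) -> mu.-integrable setT (EFin \o p) ->
  \sum_(i <- s) `|\int[mu]_(t in D i) p t| <= \int[mu]_(t in `[0, 1]) `|p t|.
Proof.
move=> mD tD us D01 intp.
have intn : mu.-integrable setT (EFin \o (fun x => `|p x|)) by exact: integrable_norm.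
have mU : measurable (\big[setU/set0]_(i <- s) D i) by exact: bigsetU_measurable.
apply: (@le_trans _ _ (\sum_(i <- s) \int[mu]_(t in D i) `|p t|)).
  apply: ler_sum => i _; apply: le_normr_Rintegral; first exact: mD.
  by apply: integrableTS => //; exact: mD.
have fint (A : set R) : measurable A -> (\int[mu]_(t in A) (`|p t|)%:E)%E \is a fin_num.
  move=> mA; apply: integrable_fin_num => //.
  exact: (@integrableTS (fun x => `|p x|)).
rewrite -lee_fin -sumEFin /Rintegral.
under eq_bigr do rewrite fineK ?fint//.
rewrite fineK ?fint// -ge0_integral_bigsetU//=; first last.
- by apply: measurable_funTS; exact: (measurable_int mu intn).
- exact: sub_trivIset tD.
apply: ge0_subset_integral => //.
  by apply: measurable_funTS; exact: (measurable_int mu intn).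
move=> x; rewrite -bigcup_seq => -[i _ /D01]/=; rewrite !in_itv/=; lra.
Qed.

End lift_density.

(** * Iterates of the lift and the arcs they carry *)

Section iterates.
Context {R : realType}.
Variables (f : diff1AC R) (F G : R -> R).
Hypotheses (fF : circle_lift f F) (acF : absc 0 1 (logder F)) (GK : cancel G F).

(** The case split follows [ziter], so that the endpoints of [f^i([a, b])] are lifted by
    [lift_ziter i a] and [lift_ziter i b]. *)
Definition lift_ziter (i : int) : R -> R :=
  match i with Posz n => iter n F | Negz n => iter n.+1 G end.

Lemma circle_lift_iter n : circle_lift (iter n f) (iter n F).
Proof.
elim: n => [|n IH]; first exact: circle_lift_id.
exact: circle_lift_comp fF IH.
Qed.

Lemma logder_id x : logder (id : R -> R) x = 0.
Proof. by rewrite /logder derive1E derive_id ln1. Qed.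

Lemma absc_logder_iter n : absc 0 1 (logder (iter n F)).
Proof.
elim: n => [|n IH]; last exact: absc_logder_comp fF (circle_lift_iter n) acF IH.
apply: (@eq_absc _ _ _ (cst 0)) => [x _|e e0].
  by rewrite logder_id.
by exists 1 => // s _ _; rewrite /incr_sum big1// => q _; rewrite subrr normr0.
Qed.

Lemma lift_ziterS i x : lift_ziter (i + 1) x = F (lift_ziter i x).
Proof.
case: i => [n|[|n]].
- by rewrite (_ : Posz n + 1 = Posz n.+1)//; lia.
- by rewrite (_ : Negz 0 + 1 = Posz 0)/= ?GK//; lia.
- by rewrite (_ : Negz n.+1 + 1 = Negz n)/= ?GK//; lia.
Qed.

Lemma lift_ziterD i n x : lift_ziter (i + Posz n) x = iter n F (lift_ziter i x).
Proof.
elim: n => [|n IH]; first by rewrite addr0.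
by rewrite iterS -IH -lift_ziterS; congr lift_ziter; lia.
Qed.

(** The cocycle relation, applied [n] times. *)
Lemma logder_iter n x : logder (iter n F) x = \sum_(j < n) logder F (iter j F x).
Proof.
elim: n x => [|n IH] x.
  by rewrite big_ord0 logder_id.
rewrite big_ord_recr/= -IH addrC.
by have /= -> := congr1 (@^~ x) (logder_comp fF (circle_lift_iter n)).
Qed.

Lemma iter_lt n x y : (iter n F x < iter n F y) = (x < y).
Proof.
apply: (leW_mono (f := iter n F)); apply: le_mono => u v.
exact: clift_lt (circle_lift_iter n) _ _.
Qed.

Lemma iterGK n : cancel (iter n G) (iter n F).
Proof.
elim: n => // n IH x; rewrite iterSr [iter n.+1 G x]iterS GK; exact: IH.
Qed.

Lemma iter_invK n : cancel (iter n f) (iter n (Defs.dinv f)).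
Proof.
elim: n => // n IH x; rewrite iterSr [iter n.+1 f x]iterS dfunK; exact: IH.
Qed.

(** For negative [i] the claims are pulled back through [iter n.+1 F], which is increasing, commutes
    with adding 1 and sends the endpoints back to [a] and [b]. *)
Lemma lift_ziter_arc i a b : a <= b -> b < a + 1 ->
  [/\ lift_ziter i a <= lift_ziter i b, lift_ziter i b < lift_ziter i a + 1 &
      ziter f i @` carc a b = carc (lift_ziter i a) (lift_ziter i b)].
Proof.
move=> ab ba; case: i => n.
  have Ln := circle_lift_iter n; split => /=.
  - exact: clift_le Ln _ _ ab.
  - by rewrite -(clift_add1 Ln) iter_lt.
  - exact: clift_image_carc Ln _ _ ab.
have Ln := circle_lift_iter n.+1; rewrite /lift_ziter.
set a' := iter n.+1 G a; set b' := iter n.+1 G b.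
have aE : iter n.+1 F a' = a by exact: iterGK.
have bE : iter n.+1 F b' = b by exact: iterGK.
have ab' : a' <= b' by rewrite leNgt -(iter_lt n.+1) aE bE -leNgt.
split => //; first by rewrite -(iter_lt n.+1) (clift_add1 Ln) aE bE.
rewrite -aE -bE -(clift_image_carc Ln ab') /ziter.
apply/seteqP; split=> [_ [_ [q cq <-] <-]|q cq]; first by rewrite iter_invK.
by exists (iter n.+1 f q); [exists q|rewrite iter_invK].
Qed.

End iterates.

(** * Lower bound on the growth of the distance to the identity *)

Theorem lemma3p2 (R : realType) (f : diff1AC R) (a b : R)
    (hab : a <= b) (hb1 : b < a + 1)
    (hdisj : trivIset [set: int] (fun i : int => ziter f i @` carc a b))
    (hsign :
      (forall i : int, ae_on (ziter f i @` carc a b) (fun p => 0 <= cderiv2 f p))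
      \/
      (forall i : int, ae_on (ziter f i @` carc a b) (fun p => cderiv2 f p <= 0))) :
  let u : nat -> R := fun n => cdist (iter n f) id / n%:R in
  let c : int -> R := fun i =>
    cintegral (ziter f i @` carc a b) (fun p => cderiv2 f p / cderiv f p) in
  [/\ cvgn u, summable [set: int] (fun i => (c i)%:E) & `|zsum c| <= limn u].
Proof.
move=> u c; have [F [G [fF acF _ GK]]] := diff1AC_lift f.
pose L := lift_ziter F G.
have arc i : [/\ L i a <= L i b, L i b < L i a + 1 &
    ziter f i @` carc a b = carc (L i a) (L i b)].
  exact: (lift_ziter_arc fF GK i hab hb1).
pose D i := fund_carc (L i a) (L i b).
have mD i : measurable (D i) by have [? ? _] := arc i; exact: measurable_fund_carc.
have D01 i : D i `<=` `[0, 1[ by move=> x [].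
have tD : trivIset setT D.
  move=> i j _ _ [x [[_ xi] [_ xj]]]; apply: hdisj => //.
  by have [_ _ ->] := arc i; have [_ _ ->] := arc j; exists (toC x).
pose d n := cdist (iter n f) id.
have dE n : d n = fine (total_variation 0 1 (logder (iter n F))).
  exact: cdist_id_lift (circle_lift_iter fF n) (absc_logder_iter fF acF n).
have tvfin n : total_variation 0 1 (logder (iter n F)) \is a fin_num.
  apply/bounded_variationP; first exact: ler01.
  exact: absc_bounded_variation ler01 (absc_logder_iter fF acF n).
(* The density of [logder F] is [f'' / f'], so [c i] is an increment of [logder F]. *)
have cE i : c i = logder F (L i b) - logder F (L i a).
  have [p [intp pE gp _]] := circle_lift_density fF acF.
  have [Lab Lba cL] := arc i.
  rewrite -(Rintegral_fund_carc Lab Lba (logder_add1 fF) intp pE).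
  rewrite /c /cintegral cL /Rintegral; congr fine.
  apply: ae_eq_integral_nonmeasurable; move: gp; apply: filterS.
    exact: (ae_filter_ringOfSetsType (@lebesgue_measure R)).
  by move=> x gp [x01 _]; rewrite gp.
(* By the cocycle relation, the density of the [n]-th iterate has integral
   [c i + ... + c (i + n - 1)] over the [i]-th arc. *)
have sum_le n (s : seq int) : uniq s ->
    \sum_(i <- s) `|\sum_(j < n) c (i + Posz j)| <= d n.
  move=> us; have Ln := circle_lift_iter fF n.
  have [p [intp pE _ tvE]] := circle_lift_density Ln (absc_logder_iter fF acF n).
  rewrite dE -tvE; apply: le_trans (sum_norm_Rintegral_le mD tD us D01 intp).
  apply: ler_sum => i _; have [Lab Lba _] := arc i.
  rewrite (Rintegral_fund_carc Lab Lba (logder_add1 Ln) intp pE) !(logder_iter fF).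
  rewrite -sumrB le_eqVlt; apply/orP; left; apply/eqP; congr (`|_|).
  by apply: eq_bigr => j _; rewrite cE /L !(lift_ziterD GK).
(* The case [n = 1] bounds the finite sums of [|c i|], whence summability. *)
have c_le (s : seq int) : uniq s -> \sum_(i <- s) `|c i| <= d 1%N.
  move=> us; apply: le_trans (sum_le 1%N s us); apply: ler_sum => i _.
  by rewrite big_ord1 addr0.
have cc := zsum_cvg_bounded c_le.
have cu : cvgn u.
  apply: (fekete (d := d)) => [n|m n]; rewrite !dE.
    by rewrite fine_ge0// total_variation_ge0.
  have FE : iter (m + n) F = iter m F \o iter n F by apply/funext => x; rewrite iterD.
  have tvD := total_variation_logder_comp (circle_lift_iter fF m)
    (circle_lift_iter fF n).
  rewrite -FE in tvD.
  have fine_leD (x y z : \bar R) : x \is a fin_num -> y \is a fin_num ->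
      z \is a fin_num -> (x <= y + z)%E -> fine x <= fine y + fine z.
    by move=> xf yf zf xyz; rewrite -fineD// fine_le// fin_numD yf.
  exact: fine_leD (tvfin (m + n)%N) (tvfin m) (tvfin n) tvD.
split => //; first exact: summable_bounded c_le.
apply: (limn_div_ge (d := d)) => // n.
(* Summed over all arcs, the windows of length [n] count each [c i] exactly [n] times. *)
have [Wc WE] := zsum_window n cc.
have -> : n%:R * `|zsum c| = `|n%:R * zsum c| by rewrite normrM (ger0_norm (ler0n R n)).
rewrite -WE; apply: (zsum_le Wc) => s us.
by apply: le_trans (ler_norm_sum _ _ _) _; exact: sum_le.
Qed.
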